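(* Let $d\ge2$, $u\in C^2(\mathbb R^d)$, and let $X$ be the gradient flow $\partial_tX(t,x)=\nabla u(X(t,x))$, $X(0,x)=x$. Let $x_*$ be an isolated critical point of $u$ with $\Delta u(x_* )=0$, and assume $x_*$ is positively (resp. negatively) stable: there exist a compact neighborhood $K_*$ of $x_*$ containing no other critical point of $u$, and a neighborhood $Q_*$ of $x_*$ with $Q_*\subset\mathrm{int}(K_* )$, such that $X(t,x)\in K_*$ for all $x\in Q_*$ and all $t\ge0$ (resp. all $t\le 0$). Assume there is a constant $C_*>0$ such that $$\Big|\int_0^t\Delta u\big(X(s,x)\big)\,ds\Big|\le C_*\quad\text{for all } x\in Q_* \text{ and all } t\ge0\ (\text{resp. } t\le0).$$ Then $u$ is constant in a neighborhood of $x_*$. *)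

(* Defs.v *)
From HB Require Import structures.
From mathcomp Require Import all_boot all_order all_algebra.
From mathcomp Require Import all_classical all_reals all_analysis.
Set Implicit Arguments. Unset Strict Implicit. Unset Printing Implicit Defensive.
Import Order.TTheory GRing.Theory Num.Theory.
Import numFieldNormedType.Exports.
Local Open Scope classical_set_scope.
Local Open Scope ring_scope.

Section Defs.
Variables (R : realType) (d : nat).

Definition ev (i : 'I_d) : 'rV[R]_d := delta_mx 0 i.

Definition pd (i : 'I_d) (f : 'rV[R]_d -> R) : 'rV[R]_d -> R :=
  fun x => 'D_(ev i) f x.

Definition grad (f : 'rV[R]_d -> R) (x : 'rV[R]_d) : 'rV[R]_d :=
  \row_i pd i f x.

Definition lap (f : 'rV[R]_d -> R) (x : 'rV[R]_d) : R :=
  \sum_(i < d) pd i (pd i f) x.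

Definition C2 (f : 'rV[R]_d -> R) : Prop :=
  [/\ forall i x, derivable f x (ev i),
      forall i, continuous (pd i f),
      forall i j x, derivable (pd i f) x (ev j)
    & forall i j, continuous (pd j (pd i f))].

Definition tint (pos : bool) (t : R) : set R :=
  [set` (if pos then `[0, t] else `[t, 0])%R].

End Defs.

(* Main.v *)
(* The hypotheses are contradictory: the flow cannot contract a neighbourhood of xs into
   xs while distorting volumes by a bounded factor.

   Put v = u or v = -u according to the sign of time, and b = grad v. Along a trajectory in
   Ks, v increases at speed |b|^2, which is bounded below away from xs; as v is bounded on
   Ks, the time spent outside a small ball around xs is bounded independently of the
   trajectory and of the time horizon T. So for T large every trajectory from a cube around
   xs spends most of [0, T] in that small ball, whereas by Liouville's formula the image of
   the cube at any time has volume at least exp(-C) times that of the cube.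

   Volumes are handled without multidimensional integration. The flow is approximated by
   compositions of shears x |-> x + tau b_i(x) e_i, whose Jacobian is 1 + tau d_i b_i; for
   each shear the change of variables formula is one-dimensional and is proved, in the limit
   of fine meshes, for sums over a cubic grid. *)
Require Import Defs.
From HB Require Import structures.
From mathcomp Require Import all_boot all_order all_algebra.
From mathcomp Require Import all_classical all_reals all_analysis.
From mathcomp Require Import ring lra zify.
Import Order.TTheory GRing.Theory Num.Theory.
Import numFieldNormedType.Exports.
Local Open Scope classical_set_scope.
Local Open Scope ring_scope.

Set Implicit Arguments.
Unset Strict Implicit.
Unset Printing Implicit Defensive.

(** * Sup norm, compactness and uniform bounds *)

Lemma ler_coord_norm (R : realType) (d : nat) (x : 'rV[R]_d) j :
  `|x ord0 j| <= `|x|.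
Proof.
rewrite [leRHS]/Num.Def.normr/= mx_normrE.
exact: (le_bigmax _ (fun ij => `|x ij.1 ij.2|) (ord0, j)).
Qed.

Lemma ler_norm_coord (R : realType) (d : nat) (x : 'rV[R]_d) e :
  0 <= e -> (forall j, `|x ord0 j| <= e) -> `|x| <= e.
Proof.
move=> e0 xe; rewrite [leLHS]/Num.Def.normr/= mx_normrE bigmax_le//= => -[i j] _.
by rewrite (ord1 i).
Qed.

Lemma continuous_dist (R : realType) (V : normedModType R) (c : V) :
  continuous (fun y : V => `|y - c|).
Proof.
move=> y.
have hc : {for y, continuous (fun _ : V => c)} by exact: cst_continuous.
have hi : {for y, continuous (@id V)} by [].
exact: (continuous_comp (continuousB hi hc) (@norm_continuous _ _ _)).
Qed.

Lemma compact_cball (R : realType) (d : nat) (c : 'rV[R]_d) r :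
  compact [set x | `|x - c| <= r].
Proof.
apply: bounded_closed_compact.
  exists (r + `|c|); split; first exact: num_real.
  move=> M rM x /= xr; apply: le_trans (ltW rM).
  by rewrite -[x in `|x|](subrK c) (le_trans (ler_normD _ _))// lerD2r.
have -> : [set x | `|x - c| <= r] = (fun x => `|x - c|) @^-1` [set y | y <= r] by [].
apply: preimage_closed; last exact: closed_le.
by move=> x _; exact: continuous_dist.
Qed.

(** Heine-Cantor through the near-covering form of compactness. Only [x] is confined to [K], so the
    modulus also covers nearby points outside [K]. *)
Lemma compact_uniform_modulus (R : realType) (V : normedModType R) (K : set V)
    (f : V -> R) e : compact K -> continuous f -> 0 < e ->
  exists2 r, 0 < r & forall x y, K x -> `|y - x| < r -> `|f y - f x| < e.
Proof.
move=> cK cf e0.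
have := (compact_near_coveringP K).1 cK R 0^'+
  (fun r x => forall y, `|y - x| < r -> `|f y - f x| < e) _.
case.
  move=> x _.
  have /cvgrPdist_lt/(_ (e / 2)) := cf x; rewrite divr_gt0// => /(_ isT).
  move=> /nbhs_normP[r /= r0 rf].
  exists (ball x (r / 2), [set s | s < r / 2]) => /=.
    split; first by apply: nbhsx_ballx; rewrite divr_gt0.
    by apply: nbhs_right_lt; rewrite divr_gt0.
  move=> [z s]/= [xz sr] y yz.
  rewrite -ball_normE /= in xz.
  have h1 : `|x - z| < r by lra.
  have h2 : `|x - y| < r.
    have -> : x - y = (x - z) - (y - z) by rewrite opprB addrA subrK.
    by rewrite (le_lt_trans (ler_normB _ _))//; lra.
  have := rf _ h1; have := rf _ h2; rewrite /= !ltr_norml; lra.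
move=> r /= r0 H.
exists (r / 2); first by rewrite divr_gt0.
move=> x y Kx; apply: (H (r / 2)) => //=; last by rewrite divr_gt0.
by rewrite sub0r normrN gtr0_norm ?divr_gt0// ltr_pdivrMr// ltr_pMr// ltr1n.
Qed.

Lemma compact_norm_bound (R : realType) (V : normedModType R) (K : set V)
    (f : V -> R) : compact K -> continuous f ->
  exists2 M, 0 < M & forall x, K x -> `|f x| <= M.
Proof.
move=> cK cf; have [[x Kx]|/set0P/negP] := pselect (K !=set0); last first.
  by rewrite negbK => /eqP ->; exists 1.
have cnf : continuous (fun x => `|f x|).
  by move=> z; apply: continuous_comp; [exact: cf|exact: norm_continuous].
have [|c _ cM] := @compact_EVT_max _ R _ K _ cK (continuous_subspaceT cnf).
  by exists x.
exists (`|f c| + 1) => [|z Kz]; first by rewrite ltr_wpDl.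
by rewrite (le_trans (cM z _)) ?inE// lerDl.
Qed.

Lemma compact_norm_bound_fin (R : realType) (V : normedModType R) (I : finType)
    (K : set V) (f : I -> V -> R) : compact K -> (forall i, continuous (f i)) ->
  exists2 M, 0 < M & forall i x, K x -> `|f i x| <= M.
Proof.
move=> cK cf.
have /choice[M HM] : forall i, exists M, 0 < M /\ forall x, K x -> `|f i x| <= M.
  by move=> i; have [M M0 HM] := compact_norm_bound cK (cf i); exists M.
exists (1 + \sum_i M i) => [|i x Kx].
  by rewrite ltr_wpDr// sumr_ge0// => i _; have [/ltW] := HM i.
have [_ /(_ x Kx) /le_trans] := HM i; apply.
rewrite (bigD1 i)//= addrCA lerDl addr_ge0// sumr_ge0// => j _.
by have [/ltW] := HM j.
Qed.

Lemma compact_uniform_modulus_fin (R : realType) (V : normedModType R) (I : finType)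
    (K : set V) (f : I -> V -> R) e : compact K -> (forall i, continuous (f i)) -> 0 < e ->
  exists2 r, 0 < r & forall i x y, K x -> `|y - x| < r -> `|f i y - f i x| < e.
Proof.
move=> cK cf e0.
have : \forall r \near 0^'+, forall i x y, K x -> `|y - x| < r -> `|f i y - f i x| < e.
  apply: filter_forall => i; have [r r0 H] := compact_uniform_modulus cK (cf i) e0.
  near=> s => x y Kx yx; apply: H => //; apply: lt_trans yx _.
  by near: s; exact: nbhs_right_lt.
move=> H; have [r [r0 Hr]] := filter_ex (filterI (nbhs_right_gt (0 : R)) H).
by exists r.
Unshelve. all: by end_near. Qed.

(** * Calculus in one variable and along lines *)

Lemma is_derive_line (R : realType) (V : normedModType R) (f : V -> R) (x v : V) (t : R) :
  derivable f (x + t *: v) v ->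
  is_derive t 1 (fun s => f (x + s *: v)) ('D_v f (x + t *: v)).
Proof.
move=> df.
have E : (fun h : R => h^-1 *: (f (h *: v + (x + t *: v)) - f (x + t *: v))) =
  (fun h : R => h^-1 *: (((fun s => f (x + s *: v)) \o shift t) (h *: 1) - f (x + t *: v))).
  apply/funext => h /=; rewrite scalerDl [h%:A]mulr1; congr (_ *: (f _ - _)).
  by rewrite addrCA.
apply: DeriveDef; first by rewrite /derivable -E; exact: df.
by rewrite /derive -E.
Qed.

Lemma derive_within_continuous (R : realType) (f df : R -> R) (a b : R) :
  (forall x, a <= x <= b -> is_derive x 1 f (df x)) ->
  {within `[a, b], continuous f}.
Proof.
move=> H; apply: continuous_in_subspaceT => x; rewrite inE /= in_itv /= => xab.
apply/differentiable_continuous/derivable1_diffP.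
by have [] := H x xab.
Qed.

Lemma mean_value (R : realType) (f df : R -> R) (a b : R) : a <= b ->
  (forall x, a <= x <= b -> is_derive x 1 f (df x)) ->
  exists2 c, a <= c <= b & f b - f a = df c * (b - a).
Proof.
move=> ab H.
have [||c cab ->] := @MVT_segment R f df a b ab.
- move=> x; rewrite in_itv/= => /andP[ax xb]; apply: H.
  by rewrite !ltW.
- exact: derive_within_continuous H.
- by exists c => //; move: cab; rewrite in_itv.
Qed.

Lemma mean_value_line (R : realType) (V : normedModType R) (f : V -> R) (x v : V) (s : R) :
  (forall y, derivable f y v) ->
  exists2 t : R, 0 <= t <= 1 &
    f (x + s *: v) - f x = s * 'D_v f (x + (t * s) *: v).
Proof.
move=> df.
have H (t : R) : is_derive t 1 (fun s => f (x + s *: v)) ('D_v f (x + t *: v)).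
  exact: is_derive_line.
have [s0|s0|<-] := ltgtP 0 s; last first.
- by exists 0; rewrite ?lexx ?ler01// !scale0r addr0 subrr mul0r.
- have [c /andP[sc c0]] := mean_value (ltW s0) (fun t _ => H t).
  rewrite scale0r addr0 sub0r => E; exists (c / s).
    by rewrite -mulrNN -invrN divr_ge0 ?oppr_ge0 ?(ltW s0)//= ler_pdivrMr ?oppr_gt0//; lra.
  by rewrite divfK ?lt_eqF// -opprB E; ring.
have [c /andP[c0 cs]] := mean_value (ltW s0) (fun t _ => H t).
rewrite scale0r addr0 subr0 => E; exists (c / s).
  by rewrite divr_ge0 ?(ltW s0)//= ler_pdivrMr// mul1r.
by rewrite divfK ?gt_eqF// E mulrC.
Qed.

Lemma continuous_affine_comp (R : realType) (V : topologicalType) (g : V -> R) (a b : R) :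
  continuous g -> continuous (fun x => a + b * g x).
Proof.
move=> cg x.
have hb : {for x, continuous (fun _ : V => b)} by exact: cst_continuous.
have ha : {for x, continuous (fun _ : V => a)} by exact: cst_continuous.
exact: (continuousD ha (continuousM hb (cg x))).
Qed.

Lemma continuous_shear (R : realType) (V : normedModType R) (g : V -> R) (v : V) (tau : R) :
  continuous g -> continuous (fun x => x + (tau * g x) *: v).
Proof.
move=> cg x.
have h0 : {for x, continuous (fun x => tau * g x)}.
  have hb : {for x, continuous (fun _ : V => tau)} by exact: cst_continuous.
  exact: (continuousM hb (cg x)).
have h1 : {for x, continuous (fun x => (tau * g x) *: v)}.
  exact: continuousZr_tmp.
have h2 : {for x, continuous (@id V)} by [].
exact: (continuousD h2 h1).
Qed.

Lemma continuous_line (R : realType) (V : normedModType R) (z v : V) :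
  continuous (fun s : R => z + s *: v).
Proof.
move=> x.
have h1 : {for x, continuous (fun x : R => x *: v)}.
  by apply: continuousZr_tmp.
have h2 : {for x, continuous (fun _ : R => z)} by exact: cst_continuous.
exact: (continuousD h2 h1).
Qed.

Lemma is_derive_continuous (R : realType) (V : normedModType R) (f : R -> V) (x : R) df :
  is_derive x 1 f df -> {for x, continuous f}.
Proof. by case=> df' _; exact/differentiable_continuous/derivable1_diffP. Qed.

(** [F] is the integral from [a], so it is differentiated only to the right of [a]; each use takes
    [a] below every point it needs. The second clause turns Lebesgue integrals over segments into
    increments of [F]. *)
Lemma antiderivative (R : realType) (f : R -> R) (a : R) : continuous f ->
  exists F : R -> R, (forall x, a < x -> is_derive x 1 F (f x)) /\
    (forall x y, a < x -> x <= y ->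
      (\int[lebesgue_measure]_(t in `[x, y]) (f t)%:E)%E = (F y - F x)%:E).
Proof.
move=> cf; pose F x : R := (\int[lebesgue_measure]_(t in `[a, x]) f t)%R.
have dF x : a < x -> is_derive x 1 F (f x).
  move=> ax.
  have [||dF DF] := @continuous_FTC1 R f (BLeft a) x (x + 1) _ _ ax (cf x).
  - by rewrite ltrDl.
  - apply: continuous_compact_integrable; first exact: segment_compact.
    exact: continuous_subspaceT.
  by apply: DeriveDef; [exact: dF|rewrite -derive1E].
exists F; split=> // x y ax; rewrite le_eqVlt => /predU1P[<-|xy].
  by rewrite set_itv1 integral_set1 subrr.
rewrite (@continuous_FTC2 R f F x y xy) ?EFinB//.
- exact: continuous_subspaceT.
- split.
  + move=> z; rewrite in_itv /= => /andP[xz _].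
    by have [] := dF z (lt_trans ax xz).
  + apply: cvg_at_right_filter; exact: is_derive_continuous (dF x ax).
  + apply: cvg_at_left_filter; exact: is_derive_continuous (dF y (lt_trans ax xy)).
- move=> z; rewrite in_itv /= => /andP[xz _].
  by rewrite derive1E; have [] := dF z (lt_trans ax xz).
Qed.

(* Both Riemann sums approximate integrals given by one antiderivative [F] of [f];
   [phi] need not be monotone, since [F] is constant outside [a, b]. *)
Lemma riemann_sum_substitution_le (R : realType) (f phi w : R -> R) (a b e : R) (N : nat) :
  a < b -> continuous f -> (forall t, 0 <= f t) ->
  (forall t, t <= a -> f t = 0) -> (forall t, b <= t -> f t = 0) ->
  (forall t : R, is_derive t 1 phi (w t)) ->
  (forall s t, a <= s <= b -> a <= t <= b -> `|s - t| <= (b - a) / N%:R ->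
     `|f s - f t| <= e /\ `|f (phi s) * w s - f (phi t) * w t| <= e) ->
  \sum_(k < N) f (phi (a + (b - a) / N%:R * k%:R)) * w (a + (b - a) / N%:R * k%:R)
  <= \sum_(k < N) f (a + (b - a) / N%:R * k%:R) + 2 * N%:R * e.
Proof.
move=> ab cf f0 fa fb dphi Hmod.
case: N Hmod => [|N] Hmod; first by rewrite !big_ord0 mulr0 mul0r addr0.
set h := (b - a) / N.+1%:R in Hmod *.
have h0 : 0 < h by rewrite divr_gt0 ?subr_gt0.
have hN : h * N.+1%:R = b - a by rewrite /h divfK.
pose t (k : nat) := a + h * k%:R.
have cphi : continuous phi by move=> x; exact: is_derive_continuous (dphi x).
have [M M0 phiM] := compact_norm_bound (@segment_compact R a b) cphi.
(* A base point strictly below both [a] and [phi] of the whole segment, so that [F] is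
   differentiable at every point used below. *)
pose a0 := - M - `|a| - 1.
have a0a : a0 < a by have := ler_norm (- a); rewrite normrN /a0; lra.
have a0phi s : a <= s <= b -> a0 < phi s.
  move=> sab; have := phiM s; rewrite /= in_itv /= => /(_ sab).
  rewrite ler_norml => /andP[+ _]; have := normr_ge0 a; rewrite /a0; lra.
have [F [dF _]] := antiderivative a0 cf.
have Fle x y : a0 < x -> x <= y -> exists2 c, x <= c <= y & F y - F x = f c * (y - x).
  move=> a0x xy; apply: mean_value => // z /andP[xz _].
  by apply: dF; exact: lt_le_trans xz.
have Fb x : a0 < x -> F x <= F b.
  move=> a0x; have [xb|bx] := leP x b.
    have [c _ E] := Fle _ _ a0x xb.
    by rewrite -subr_ge0 E mulr_ge0// subr_ge0.
  have [c /andP[bc _] E] := Fle _ _ (lt_trans a0a ab) (ltW bx).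
  by rewrite -subr_le0 E fb// mul0r.
have Fa x : a0 < x -> F a <= F x.
  move=> a0x; have [ax|xa] := leP a x.
    have [c _ E] := Fle _ _ a0a ax.
    by rewrite -subr_ge0 E mulr_ge0// subr_ge0.
  have [c /andP[_ ca] E] := Fle _ _ a0x (ltW xa).
  by rewrite -subr_le0 E fa// mul0r.
have tab k : (k <= N.+1)%N -> a <= t k <= b.
  move=> kN; rewrite /t lerDl mulr_ge0 ?ler0n ?(ltW h0)//= -lerBrDl -hN.
  by rewrite ler_wpM2l ?(ltW h0)// ler_nat.
have tS k : t k.+1 - t k = h by rewrite /t -[k.+1]addn1 natrD; ring.
have t0E : t 0%N = a by rewrite /t mulr0 addr0.
have tNE : t N.+1 = b by rewrite /t hN addrC subrK.
have close k c : (k < N.+1)%N -> t k <= c <= t k.+1 ->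
    a <= c <= b /\ `|c - t k| <= h.
  move=> kN /andP[kc ck]; have /andP[ak _] := tab k (ltnW kN).
  have /andP[_ kb] := tab k.+1 kN; split; first by rewrite (le_trans ak)// (le_trans ck).
  by rewrite ger0_norm ?subr_ge0// -(tS k) lerB.
(* The mean value theorem for [F \o phi] on each cell, then telescoping to [F (phi b) - F (phi a)].
   This is at most [F b - F a] wherever [phi] sends the endpoints, because [f] is nonnegative and
   vanishes outside the segment. *)
have up : \sum_(k < N.+1) (f (phi (t k)) * w (t k) - e) * h <= F b - F a.
  apply: le_trans (lerB (Fb (phi b) (a0phi b _)) (Fa (phi a) (a0phi a _))); last 2 first.
    by rewrite lexx ltW.
    by rewrite lexx ltW.
  rewrite -{1}tNE -{1}t0E -(telescope_sumr (fun k => F (phi (t k))) (leq0n _)) big_mkord.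
  apply: ler_sum => k _.
  have tk : t k <= t k.+1 by rewrite -subr_ge0 tS ltW.
  have [|c kc ->] := @mean_value R (F \o phi) (fun s => f (phi s) * w s) _ _ tk.
    move=> s ks; have [sab _] := close _ _ (ltn_ord k) ks.
    apply: is_derive1_comp.
    by apply: dF; exact: a0phi.
  have [cab ck] := close _ _ (ltn_ord k) kc.
  rewrite tS ler_wpM2r ?(ltW h0)//.
  have [_] := Hmod c (t k) cab (tab k (ltnW (ltn_ord k))) ck.
  by rewrite ler_norml; lra.
have dn : F b - F a <= \sum_(k < N.+1) (f (t k) + e) * h.
  rewrite -{1}tNE -{1}t0E -(telescope_sumr (fun k => F (t k)) (leq0n _)) big_mkord.
  apply: ler_sum => k _.
  have tk : t k <= t k.+1 by rewrite -subr_ge0 tS ltW.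
  have a0k : a0 < t k by have /andP[ak _] := tab k (ltnW (ltn_ord k)); exact: lt_le_trans ak.
  have [c kc ->] := Fle _ _ a0k tk.
  have [cab ck] := close _ _ (ltn_ord k) kc.
  rewrite tS ler_wpM2r ?(ltW h0)//.
  have [+ _] := Hmod c (t k) cab (tab k (ltnW (ltn_ord k))) ck.
  by rewrite ler_norml; lra.
have := le_trans up dn; rewrite -!mulr_suml ler_pM2r// big_split/= sumrN.
rewrite big_split/= !sumr_const card_ord -mulr_natl.
by rewrite -/h -/(t _); lra.
Qed.

(** * Sums over a cubic grid and their behaviour under one shear *)

Section grid.
Context (R : realType) (d : nat).
Variables (c : 'rV[R]_d) (A : R).

Definition grid_point N (k : {ffun 'I_d -> 'I_N}) : 'rV[R]_d :=
  \row_i (c ord0 i - A + (2 * A / N%:R) * (k i)%:R).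

(** A Riemann sum without its factor [(2 * A / N%:R) ^+ d]; this is why admissible errors below have
    the size [e * N%:R ^+ d]. *)
Definition grid_sum N (f : 'rV[R]_d -> R) : R :=
  \sum_(k : {ffun 'I_d -> 'I_N}) f (grid_point k).

Definition grid_update N (k : {ffun 'I_d -> 'I_N}) i (m : 'I_N) :=
  [ffun j => if j == i then m else k j].

(** Exchanging [k i] with the extra index [m] is an involution on pairs, and it makes the inner
    index idle. The left side is a sum over lines parallel to axis [i], each line being counted [N]
    times. *)
Lemma sum_grid_update N (F : {ffun 'I_d -> 'I_N} -> R) i :
  \sum_k \sum_m F (grid_update k i m) = N%:R * \sum_k F k.
Proof.
rewrite pair_big /=.
pose s (p : {ffun 'I_d -> 'I_N} * 'I_N) := (grid_update p.1 i p.2, p.1 i).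
have sK : involutive s.
  move=> [k m]; rewrite /s /=; congr pair; last by rewrite ffunE eqxx.
  by apply/ffunP => j; rewrite !ffunE; case: eqP => // ->.
rewrite (reindex_inj (inv_inj sK)) /=.
under eq_bigr => p _.
  have -> : grid_update (grid_update p.1 i p.2) i (p.1 i) = p.1.
    by have := sK p; case: p => k m /= [].
  over.
rewrite -(pair_big xpredT xpredT (fun k m => F k)) /= mulr_sumr.
by apply: eq_bigr => k _; rewrite sumr_const card_ord mulr_natl.
Qed.

Lemma grid_point_cball N (k : {ffun 'I_d -> 'I_N}) : 0 < A -> `|grid_point k - c| <= A.
Proof.
move=> A0; apply: ler_norm_coord => [|j]; first exact: ltW.
rewrite !mxE; have N0 : (0 < N)%N by case: (N) (k j) => // -[].
have : 0 <= (2 * A / N%:R) * (k j)%:R <= 2 * A.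
  rewrite mulr_ge0 ?divr_ge0 ?mulr_ge0 ?(ltW A0)//=.
  rewrite -mulrA ler_piMr ?mulr_ge0 ?(ltW A0)// mulrC ler_pdivrMr ?ltr0n//.
  by rewrite mul1r ler_nat ltnW.
rewrite ler_norml; lra.
Qed.

(* The shear preserves the lines in direction [ev R i], so
   [riemann_sum_substitution_le] applies line by line. *)
Lemma grid_sum_shear (f g : 'rV[R]_d -> R) (i : 'I_d) (tau e : R) :
  0 < A -> 0 < e ->
  continuous f -> (forall x, 0 <= f x) -> (forall x, A <= `|x - c| -> f x = 0) ->
  (forall x, derivable g x (ev R i)) -> continuous g -> continuous (pd i g) ->
  exists N0, forall N, (N0 <= N)%N ->
    grid_sum N (fun x => f (x + (tau * g x) *: ev R i) * (1 + tau * pd i g x))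
    <= grid_sum N f + e * N%:R ^+ d.
Proof.
move=> A0 e0 cf f0 fA dg cg cdg.
pose G (x : 'rV[R]_d) := f (x + (tau * g x) *: ev R i) * (1 + tau * pd i g x).
have cG : continuous G.
  move=> x; have cfs := continuous_comp (@continuous_shear R _ g (ev R i) tau cg x) (cf _).
  exact: (continuousM cfs (@continuous_affine_comp R _ _ 1 tau cdg x)).
have e2 : 0 < e / 2 by rewrite divr_gt0.
have [r1 r10 Hf] := compact_uniform_modulus (compact_cball (c := c) (r := A)) cf e2.
have [r2 r20 HG] := compact_uniform_modulus (compact_cball (c := c) (r := A)) cG e2.
pose r := Num.min r1 r2.
have r0 : 0 < r by rewrite lt_min r10.
exists (Num.truncn (2 * A / r)).+1 => N N0N.
have rN : 2 * A / N%:R < r.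
  have N0 : (0 < N)%N by exact: leq_trans N0N.
  rewrite ltr_pdivrMr ?ltr0n// [r * _]mulrC -ltr_pdivrMr//.
  apply: (lt_le_trans (truncnS_gt (2 * A / r))).
  by rewrite ler_nat.
have N0 : (0 < N)%N by exact: leq_trans N0N.
(* After multiplication by [N], both grid sums become sums over lines, and the allowed error is
   shared equally among the indices [k]. *)
rewrite -(ler_pM2l (_ : 0 < N%:R)) ?ltr0n// mulrDr -!(sum_grid_update _ i).
have -> : N%:R * (e * N%:R ^+ d) = \sum_(k : {ffun 'I_d -> 'I_N}) (2 * N%:R * (e / 2)).
  by rewrite sumr_const card_ffun !card_ord -[RHS]mulr_natr natrX; field.
rewrite -big_split /=; apply: ler_sum => k _.
(* The line through the grid point in direction [i], with its origin at coordinate 0, so that the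
   parameter on the line is the [i]-th coordinate itself. *)
pose z : 'rV[R]_d := \row_j (if j == i then 0 else grid_point k ord0 j).
pose a := c ord0 i - A; pose b := c ord0 i + A.
have ba : b - a = 2 * A by rewrite /a /b; ring.
have gpE m : grid_point (grid_update k i m) = z + (a + (b - a) / N%:R * m%:R) *: ev R i.
  apply/rowP => j; rewrite !mxE ffunE ba; case: eqP => [->|/eqP ji].
    by rewrite !eqxx mulr1 add0r.
  by rewrite eqxx /= mulr0 addr0.
have zs_i s : (z + s *: ev R i) ord0 i = s by rewrite !mxE !eqxx mulr1 add0r.
have zin s : a <= s <= b -> `|z + s *: ev R i - c| <= A.
  move=> sab; apply: ler_norm_coord => [|j]; first exact: ltW.
  have [->|ji] := eqVneq j i.
    rewrite mxE zs_i mxE ler_norml; move: sab; rewrite /a /b; lra.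
  have := le_trans (ler_coord_norm (grid_point k - c) j) (grid_point_cball k A0).
  by rewrite !mxE eqxx (negbTE ji) /= mulr0 addr0.
have zout s : A <= `|s - c ord0 i| -> f (z + s *: ev R i) = 0.
  move=> As; apply: fA; apply: le_trans (ler_coord_norm _ i).
  by rewrite mxE zs_i mxE.
under eq_bigr do rewrite gpE; under [X in _ <= X + _]eq_bigr do rewrite gpE.
pose phi s := s + tau * g (z + s *: ev R i).
have phiE s : z + s *: ev R i + (tau * g (z + s *: ev R i)) *: ev R i = z + phi s *: ev R i.
  by rewrite /phi scalerDl addrA.
under eq_bigr do rewrite phiE.
apply: (@riemann_sum_substitution_le R (fun s => f (z + s *: ev R i)) phi
  (fun s => 1 + tau * pd i g (z + s *: ev R i))).
- by rewrite /a /b; lra.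
- by move=> s; apply: continuous_comp; [exact: continuous_line|exact: cf].
- by move=> s.
- move=> s sa; apply: zout; rewrite distrC ger0_norm; move: sa; rewrite /a; lra.
- move=> s sa; apply: zout; rewrite ger0_norm; move: sa; rewrite /b; lra.
- move=> s; apply: is_deriveD.
  have dgs : is_derive s 1 (fun s => g (z + s *: ev R i)) (pd i g (z + s *: ev R i)).
    by apply: is_derive_line.
  exact: is_deriveZ.
- move=> s t sab tab; rewrite ba => st.
  have norm_st : `|z + s *: ev R i - (z + t *: ev R i)| < r.
    rewrite opprD addrACA subrr add0r -scalerBl.
    apply: le_lt_trans rN; apply: ler_norm_coord => [|j].
      by rewrite divr_ge0// mulr_ge0// ltW.
    rewrite !mxE eqxx /=; case: eqP => _; rewrite ?mulr1// mulr0 normr0.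
    by rewrite divr_ge0// mulr_ge0// ltW.
  move: norm_st; rewrite lt_min => /andP[st1 st2]; split.
    by apply/ltW/Hf => //=; exact: zin.
  have := HG _ _ (zin _ tab) st2; rewrite /G !phiE => /ltW; exact.
Qed.

End grid.

(** Bounds a Jacobian factor below by an exponential at quadratic cost. It follows from
    [1 + x <= expR x] at [x = - (y - 2 * y ^+ 2)], since [(1 - y + 2 * y ^+ 2) * (1 + y)] is at
    least 1. *)
Lemma expR_le_1Dx (R : realType) (y : R) : `|y| <= 1 / 2 ->
  expR (y - 2 * y ^+ 2) <= 1 + y.
Proof.
rewrite ler_norml => /andP[y1 y2].
have y0 : 0 < 1 + y by lra.
rewrite -[leLHS]invrK -expRN -[leRHS]invrK lef_pV2 ?posrE ?expR_gt0 ?invr_gt0//.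
apply: le_trans (expR_ge1Dx _).
rewrite -[leLHS]mul1r ler_pdivrMr//.
have -> : (1 + - (y - 2 * y ^+ 2)) * (1 + y) = 1 + y ^+ 2 * (1 + 2 * y) by ring.
by rewrite lerDl mulr_ge0 ?sqr_ge0//; lra.
Qed.

(** * Compositions of shears, their Jacobians and the associated pull-backs *)

Section splitting.
Context (R : realType) (d : nat).
Notation E := 'rV[R]_d.
Variables (c : E) (A : R) (b : 'I_d -> E -> R) (tau : R).
Hypothesis A0 : 0 < A.
Hypothesis tau0 : 0 < tau.
Hypothesis db : forall i j x, derivable (b i) x (ev R j).
Hypothesis cb : forall i, continuous (b i).
Hypothesis cdb : forall i j, continuous (pd j (b i)).

Definition shear i (x : E) : E := x + (tau * b i x) *: ev R i.

Definition jac i (x : E) : R := 1 + tau * pd i (b i) x.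

Definition cutoff (x : E) : R := Num.max 0 (Num.min 1 (A - `|x - c|)).

(* The cutoff keeps supports in the cube of radius [A] and only decreases grid sums. *)
Definition pull i (f : E -> R) (x : E) : R := cutoff x * (f (shear i x) * jac i x).

Definition pulls (s : seq 'I_d) (f : E -> R) : E -> R := foldr pull f s.

Fixpoint act (s : seq 'I_d) (x : E) : E :=
  if s is i :: s' then act s' (shear i x) else x.

(** Each shear is paired with the point to which it is applied, so that increments along [act] are
    sums, and its Jacobian a product, over one list. *)
Fixpoint trace (s : seq 'I_d) (x : E) : seq ('I_d * E) :=
  if s is i :: s' then (i, x) :: trace s' (shear i x) else [::].

(** By the chain rule, the Jacobian determinant of [act s] at [x]. *)
Definition weight (s : seq 'I_d) (x : E) : R :=
  \prod_(p <- trace s x) jac p.1 p.2.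

Definition bump (f : E -> R) : Prop :=
  [/\ continuous f, forall x, 0 <= f x & forall x, A <= `|x - c| -> f x = 0].

(** For continuous functions supported in the cube, this amounts to comparing integrals: divided by
    [N%:R ^+ d], the sums converge to them up to a common factor. *)
Definition grid_le (f g : E -> R) : Prop := forall e, 0 < e ->
  exists N0, forall N, (N0 <= N)%N -> grid_sum c A N f <= grid_sum c A N g + e * N%:R ^+ d.

Lemma grid_le_refl f : grid_le f f.
Proof. by move=> e e0; exists 0%N => N _; rewrite lerDl mulr_ge0 ?exprn_ge0// ltW. Qed.

Lemma grid_le_trans f g h : grid_le f g -> grid_le g h -> grid_le f h.
Proof.
move=> fg gh e e0; have e2 : 0 < e / 2 by rewrite divr_gt0.
have [N1 H1] := fg _ e2; have [N2 H2] := gh _ e2.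
exists (maxn N1 N2) => N; rewrite geq_max => /andP[/H1 h1 /H2 h2].
lra.
Qed.

Lemma cutoff_itv x : 0 <= cutoff x <= 1.
Proof. by rewrite /cutoff le_max lexx /= ge_max ler01 ge_min lexx. Qed.

Lemma cutoff_eq0 x : A <= `|x - c| -> cutoff x = 0.
Proof. by move=> Ax; apply/max_idPl; rewrite ge_min subr_le0 Ax orbT. Qed.

Lemma cutoff_eq1 x : `|x - c| <= A - 1 -> cutoff x = 1.
Proof.
move=> Ax; rewrite /cutoff; have /min_idPl -> : 1 <= A - `|x - c| by lra.
by apply/max_idPr.
Qed.

Lemma continuous_cutoff : continuous cutoff.
Proof.
move=> x.
have h1 : {for x, continuous (fun x : E => `|x - c|)} by exact: continuous_dist.
have h2 : {for x, continuous (fun _ : E => A)} by exact: cst_continuous.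
have h3 : {for x, continuous (fun _ : E => 1 : R)} by exact: cst_continuous.
have h4 : {for x, continuous (fun _ : E => 0 : R)} by exact: cst_continuous.
exact: (continuous_max h4 (continuous_min h3 (continuousB h2 h1))).
Qed.

Section jacobian_nonneg.
Hypothesis jac0 : forall i x, `|x - c| <= A -> 0 <= jac i x.

Lemma bump_pull i f : bump f -> bump (pull i f).
Proof.
move=> [cf f0 fA]; split.
- move=> x; apply: continuousM; first exact: continuous_cutoff.
  have h1 := continuous_comp (@continuous_shear R _ (b i) (ev R i) tau (@cb i) x) (cf _).
  exact: (continuousM h1 (@continuous_affine_comp R _ _ 1 tau (@cdb i i) x)).
- move=> x; have [xA|/ltW Ax] := leP `|x - c| A.
    by rewrite /pull !mulr_ge0// ?jac0//; have /andP[] := cutoff_itv x.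
  by rewrite /pull cutoff_eq0// mul0r.
- by move=> x Ax; rewrite /pull cutoff_eq0// mul0r.
Qed.

Lemma grid_le_pull i f : bump f -> grid_le (pull i f) f.
Proof.
move=> [cf f0 fA] e e0.
have [N0 H] := grid_sum_shear tau A0 e0 cf f0 fA (@db i i) (@cb i) (@cdb i i).
exists N0 => N /H; apply: le_trans.
apply: ler_sum => k _; have kA := grid_point_cball c k A0.
rewrite /pull -[leRHS]mul1r ler_wpM2r//; last by have /andP[] := cutoff_itv (grid_point c A k).
by rewrite mulr_ge0// jac0.
Qed.

Lemma bump_pulls s f : bump f -> bump (pulls s f).
Proof. by move=> bf; elim: s => //= i s; exact: bump_pull. Qed.

Lemma grid_le_pulls s f : bump f -> grid_le (pulls s f) f.
Proof.
move=> bf; elim: s => [|i s IH] /=; first exact: grid_le_refl.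
exact: grid_le_trans (grid_le_pull i (bump_pulls s bf)) IH.
Qed.

Lemma bump_iter_pulls s k f : bump f -> bump (iter k (pulls s) f).
Proof. by move=> bf; elim: k => //= k; exact: bump_pulls. Qed.

Lemma grid_le_iter_pulls s k f : bump f -> grid_le (iter k (pulls s) f) f.
Proof.
move=> bf; elim: k => [|k IH] /=; first exact: grid_le_refl.
exact: grid_le_trans (grid_le_pulls s (bump_iter_pulls s k bf)) IH.
Qed.

End jacobian_nonneg.

Lemma sum_trace (s : seq 'I_d) x (G : 'I_d -> R) :
  \sum_(p <- trace s x) G p.1 = \sum_(i <- s) G i.
Proof.
by elim: s x => [|i s IH] x /=; rewrite ?big_nil// !big_cons IH.
Qed.

Lemma sum_trace_ge (s : seq 'I_d) x (F : 'I_d -> E -> R) (G : 'I_d -> R) :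
  (forall p, p \in trace s x -> G p.1 <= F p.1 p.2) ->
  \sum_(i <- s) G i <= \sum_(p <- trace s x) F p.1 p.2.
Proof.
by move=> H; rewrite -(sum_trace s x) big_seq [leRHS]big_seq; apply: ler_sum.
Qed.

(** Telescoping along the trace. It serves both for the coordinates and for the potential. *)
Lemma act_sub (v : E -> R) s x :
  v (act s x) - v x = \sum_(p <- trace s x) (v (shear p.1 p.2) - v p.2).
Proof.
elim: s x => [|i s IH] x /=; first by rewrite big_nil subrr.
by rewrite big_cons -IH [RHS]addrC subrKA.
Qed.

(** As long as the trace stays where [cutoff] is 1, each pull is an exact change of variables and
    the Jacobian factors multiply up. *)
Lemma pulls_act f s x : (forall p, p \in trace s x -> `|p.2 - c| <= A - 1) ->
  pulls s f x = f (act s x) * weight s x.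
Proof.
elim: s x => [|i s IH] x /= H; first by rewrite /weight /= big_nil mulr1.
rewrite /pull cutoff_eq1 ?mul1r; last by have := H (i, x); rewrite mem_head; apply.
rewrite IH; last by move=> p ps; apply: H; rewrite in_cons ps orbT.
by rewrite /weight /= big_cons /= -mulrA [_ * jac i x]mulrC.
Qed.

Variables (M L M1 : R).
Hypothesis M0 : 0 < M.
Hypothesis L0 : 0 < L.
Hypothesis bM : forall i x, `|x - c| <= A -> `|b i x| <= M.
Hypothesis bL : forall i x y, `|x - c| <= A -> `|y - c| <= A ->
  `|b i x - b i y| <= L * `|x - y|.
Hypothesis dbM : forall i x, `|x - c| <= A -> `|pd i (b i) x| <= M1.
Hypothesis tauM1 : tau * M1 <= 1 / 2.

Lemma norm_ev i (s : R) : `|s *: ev R i : E| <= `|s|.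
Proof.
apply: ler_norm_coord => // j; rewrite !mxE eqxx /=.
by case: eqP => _; rewrite ?mulr1 ?mulr0 ?normr0.
Qed.

Lemma shear_dist i x : `|x - c| <= A -> `|shear i x - x| <= tau * M.
Proof.
move=> xA; rewrite /shear addrC addKr (le_trans (norm_ev _ _))//.
by rewrite normrM (gtr0_norm tau0) ler_pM2l// bM.
Qed.

Lemma trace_dist s x : `|x - c| + (size s)%:R * (tau * M) <= A ->
  forall p, p \in trace s x -> `|p.2 - x| <= (size s)%:R * (tau * M).
Proof.
have tM : 0 < tau * M by rewrite mulr_gt0.
elim: s x => [//|i s IH] x /= H p.
move: H; rewrite -[(size s).+1]addn1 natrD mulrDl mul1r => H.
have sM : 0 <= (size s)%:R * (tau * M) by rewrite mulr_ge0// ltW.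
rewrite in_cons => /predU1P[->|/=]; first by rewrite subrr normr0 addr_ge0// ltW.
have xs := @shear_dist i x _; have xA : `|x - c| <= A by lra.
have sx := xs xA; have scx : `|shear i x - c| <= `|shear i x - x| + `|x - c|.
  by rewrite -[shear i x - c](subrKA x) ler_normD.
move=> /(IH _ _) px; have {}px : `|p.2 - shear i x| <= (size s)%:R * (tau * M).
  by apply: px; lra.
have : `|p.2 - x| <= `|p.2 - shear i x| + `|shear i x - x|.
  by rewrite -[p.2 - x](subrKA (shear i x)) ler_normD.
lra.
Qed.

(** * One time step: a shear along every axis in turn *)

Section step.
Variable x : E.
(** The margin 1 keeps the trace where [cutoff] is 1. Of the [d.+1] displacements, [d] account for
    the trace and the last one for a point moved by a further shear. *)
Hypothesis xA : `|x - c| + d.+1%:R * (tau * M) <= A - 1.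
Let r := d%:R * (tau * M).
Let s := enum 'I_d.

Let tM0 : 0 < tau * M. Proof. by rewrite mulr_gt0. Qed.

Let r0 : 0 <= r. Proof. by rewrite mulr_ge0// ltW. Qed.

Let rx : `|x - c| + r + tau * M <= A - 1.
Proof. by move: xA; rewrite /r -[d.+1]addn1 natrD mulrDl mul1r addrA. Qed.

Let trace_near p : p \in trace s x -> `|p.2 - x| <= r.
Proof.
have := @trace_dist s x; rewrite size_enum_ord; apply.
by move: rx tM0; rewrite /r; lra.
Qed.

Let near_ball z : `|z - x| <= r -> `|z - c| <= A - 1 - tau * M.
Proof.
have : `|z - c| <= `|z - x| + `|x - c| by rewrite -[z - c](subrKA x) ler_normD.
by move: rx; lra.
Qed.

Lemma pulls_step f : pulls s f x = f (act s x) * weight s x.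
Proof.
apply: pulls_act => p /trace_near/near_ball; have := tM0; lra.
Qed.

(** Discrete Liouville formula: [expR_le_1Dx] is applied to each Jacobian factor, and all
    derivatives are evaluated within distance [r] of [x], where [q] bounds them below. *)
Lemma weight_step_ge (q : 'I_d -> R) :
  (forall i z, `|z - x| <= r -> q i <= pd i (b i) z) ->
  expR (tau * (\sum_i q i) - d%:R * (2 * (tau * M1) ^+ 2)) <= weight s x.
Proof.
move=> Hq.
have -> : tau * (\sum_i q i) - d%:R * (2 * (tau * M1) ^+ 2) =
    \sum_(i <- s) (tau * q i - 2 * (tau * M1) ^+ 2).
  rewrite /s big_enum /= sumrB -mulr_sumr sumr_const card_ord.
  by rewrite mulr_natl.
apply: (@le_trans _ _ (expR (\sum_(p <- trace s x)
    (tau * pd p.1 (b p.1) p.2 - 2 * (tau * pd p.1 (b p.1) p.2) ^+ 2)))).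
  rewrite ler_expR; apply: (@sum_trace_ge s x (fun i z => tau * pd i (b i) z
    - 2 * (tau * pd i (b i) z) ^+ 2) (fun i => tau * q i - 2 * (tau * M1) ^+ 2)).
  move=> p /trace_near px; apply: lerB; first by rewrite ler_pM2l// Hq.
  rewrite ler_pM2l// !exprMn ler_pM2l ?exprn_gt0// -real_normK ?num_real//.
  have pA : `|p.2 - c| <= A by have := near_ball px; have := tM0; lra.
  have h := @dbM p.1 p.2 pA.
  by rewrite lerXn2r ?nnegrE// (le_trans _ h).
rewrite expR_sum /weight big_seq [leRHS]big_seq; apply: ler_prod => p /trace_near px.
rewrite expR_ge0 /=; apply: expR_le_1Dx.
have pA : `|p.2 - c| <= A by have := near_ball px; have := tM0; lra.
rewrite normrM gtr0_norm//; apply: le_trans tauM1.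
by rewrite ler_pM2l// dbM.
Qed.

(** The shears together make an Euler step: only the [j]-th one moves coordinate [j], and it
    evaluates [b j] within [r] of [x], so the Lipschitz bound controls the difference. *)
Lemma act_step_dist : `|act s x - x - tau *: \row_j b j x| <= tau * (L * r).
Proof.
apply: ler_norm_coord => [|j]; first by rewrite !mulr_ge0// ltW.
rewrite !mxE.
have -> : act s x ord0 j - x ord0 j = _ := act_sub (fun z : E => z ord0 j) s x.
(* Used with [e = 1] and [e = -1] for the two sides of the absolute value; the factor [(j == i)%:R]
   selects the one shear that moves coordinate [j]. *)
have key (e : R) (F : 'I_d -> E -> R) :
    (forall i z, `|z - x| <= r -> (tau * (e * b i x - L * r)) * (j == i)%:R <= F i z) ->
    tau * (e * b j x - L * r) <= \sum_(p <- trace s x) F p.1 p.2.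
  move=> HF; have -> : tau * (e * b j x - L * r) =
      \sum_(i <- s) (tau * (e * b i x - L * r)) * (j == i)%:R.
    rewrite /s big_enum /= (bigD1 j)//= eqxx mulr1 big1 ?addr0// => i.
    by rewrite eq_sym => /negbTE ->; rewrite mulr0.
  apply: (@sum_trace_ge s x F (fun i => (tau * (e * b i x - L * r)) * (j == i)%:R)).
  by move=> p /trace_near; exact: HF.
have bz i z : `|z - x| <= r -> `|b i z - b i x| <= L * r.
  move=> zx; apply: le_trans (@bL i z x _ _) _.
  - by have := near_ball zx; have := tM0; lra.
  - by move: rx r0 tM0; lra.
  - by rewrite ler_pM2l.
have FE i z : shear i z ord0 j - z ord0 j = tau * b i z * (j == i)%:R.
  by rewrite /shear !mxE eqxx /=; ring.
rewrite ler_norml; apply/andP; split.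
  have := key 1 (fun i z => shear i z ord0 j - z ord0 j) _; rewrite mul1r.
  set S := \sum_(p <- _) _ => H; have {}H : tau * (b j x - L * r) <= S.
    apply: H => i z zx; rewrite FE ler_wpM2r// ler_pM2l// mul1r.
    by have := bz i z zx; rewrite ler_norml; lra.
  lra.
have := key (-1) (fun i z => - (shear i z ord0 j - z ord0 j)) _; rewrite mulN1r sumrN.
set S := \sum_(p <- _) _ => H; have {}H : tau * (- b j x - L * r) <= - S.
  apply: H => i z zx; rewrite FE mulN1r (_ : - (_ * _%:R) = tau * (- b i z) * (j == i)%:R); last by ring.
  rewrite ler_wpM2r// ler_pM2l//.
  by have := bz i z zx; rewrite ler_norml; lra.
lra.
Qed.

(** By the mean value theorem, the shear applied at [z] changes [v] by [tau * b i z * b i y] with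
    [y] between [z] and its image. Both factors are close to [b i x]. *)
Lemma potential_step_ge (v : E -> R) : (forall i y, is_derive y (ev R i) v (b i y)) ->
  tau * (\sum_i (b i x) ^+ 2 - d%:R * (2 * L * M * (r + tau * M)))
  <= v (act s x) - v x.
Proof.
move=> dv; rewrite act_sub.
have -> : tau * (\sum_i (b i x) ^+ 2 - d%:R * (2 * L * M * (r + tau * M))) =
    \sum_(i <- s) tau * ((b i x) ^+ 2 - 2 * L * M * (r + tau * M)).
  rewrite /s big_enum /= -mulr_sumr sumrB sumr_const card_ord.
  by rewrite mulr_natl.
apply: (@sum_trace_ge s x (fun i z => v (shear i z) - v z)
  (fun i => tau * ((b i x) ^+ 2 - 2 * L * M * (r + tau * M)))) => -[i z] /= /trace_near /= zx.
have zA := near_ball zx.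
have xA' : `|x - c| <= A by move: rx r0 tM0; lra.
have zA' : `|z - c| <= A by have := tM0; lra.
have [|t tz ->] := @mean_value_line R _ v z (ev R i) (tau * b i z).
  by move=> y; have [] := dv i y.
set y := z + _; have [_ dvy] := dv i y; rewrite dvy.
have tM : `|t * (tau * b i z)| <= tau * M.
  have /andP[t0 t1] := tz; rewrite normrM (ger0_norm t0).
  rewrite (le_trans (ler_piMl _ t1))// normrM gtr0_norm// ler_pM2l//.
  exact: bM.
have yz : `|y - z| <= tau * M by rewrite /y addrC addKr (le_trans (norm_ev _ _)).
have yx : `|y - x| <= r + tau * M.
  have : `|y - x| <= `|y - z| + `|z - x| by rewrite -[y - x](subrKA z) ler_normD.
  lra.
have yA : `|y - c| <= A.
  have : `|y - c| <= `|y - z| + `|z - c| by rewrite -[y - c](subrKA z) ler_normD.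
  lra.
have h1 : `|b i z - b i x| <= L * (r + tau * M).
  by rewrite (le_trans (bL _ zA' xA'))// ler_pM2l//; have := tM0; lra.
have h2 : `|b i y - b i x| <= L * (r + tau * M).
  by rewrite (le_trans (bL _ yA xA'))// ler_pM2l.
rewrite -[leRHS]mulrA ler_pM2l//.
have h3 : `|(b i z - b i x) * b i y + b i x * (b i y - b i x)| <= 2 * L * M * (r + tau * M).
  rewrite (le_trans (ler_normD _ _))// !normrM.
  have -> : 2 * L * M * (r + tau * M) =
    (L * (r + tau * M)) * M + M * (L * (r + tau * M)) by ring.
  by rewrite lerD// ler_pM ?normr_ge0// bM.
move: h3; rewrite ler_norml => /andP[h3 _].
by lra.
Qed.

End step.

End splitting.

(** The coordinates of [y] are replaced by those of [x] one at a time. A ball of the sup norm is a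
    product of intervals, so the intermediate points and the segments joining them stay inside. *)
Lemma lipschitz_cball (R : realType) (d : nat) (c : 'rV[R]_d) (A M : R)
    (f : 'rV[R]_d -> R) x y : 0 <= A -> (forall i z, derivable f z (ev R i)) ->
  (forall i z, `|z - c| <= A -> `|pd i f z| <= M) ->
  `|x - c| <= A -> `|y - c| <= A -> `|f x - f y| <= d%:R * M * `|x - y|.
Proof.
move=> A0 df fM xA yA.
pose mix k : 'rV[R]_d := \row_i (if (i < k)%N then x ord0 i else y ord0 i).
have mix0 : mix 0%N = y by apply/rowP => i; rewrite !mxE.
have mixd : mix d = x by apply/rowP => i; rewrite !mxE ltn_ord.
have -> : f x - f y = f (mix d) - f (mix 0%N) by rewrite mixd mix0.
rewrite -(telescope_sumr (fun k => f (mix k)) (leq0n d)) big_mkord.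
apply: le_trans (ler_norm_sum _ _ _) _.
have -> : d%:R * M * `|x - y| = \sum_(k < d) M * `|x - y|.
  by rewrite sumr_const card_ord -[RHS]mulr_natl mulrA.
apply: ler_sum => k _.
have mixS : mix k.+1 = mix k + (x ord0 k - y ord0 k) *: ev R k.
  apply/rowP => i; rewrite !mxE eqxx /= ltnS leq_eqVlt.
  have [->|ik] := eqVneq i k; first by rewrite eqxx ltnn mulr1 addrC subrK.
  by rewrite [_ == _ :> nat](negbTE ik) mulr0 addr0.
have [|t /andP[t0 t1]] := @mean_value_line R _ f (mix k) (ev R k) (x ord0 k - y ord0 k).
  exact: df.
rewrite -mixS => ->; rewrite normrM mulrC ler_pM//.
  apply: fM; apply: ler_norm_coord => // i; rewrite !mxE eqxx /=.
  have xi : `|x ord0 i - c ord0 i| <= A.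
    by have := ler_coord_norm (x - c) i; rewrite !mxE => /le_trans; apply.
  have yi : `|y ord0 i - c ord0 i| <= A.
    by have := ler_coord_norm (y - c) i; rewrite !mxE => /le_trans; apply.
  have [ik|ik] := eqVneq i k; last by rewrite mulr0 addr0; case: ifP.
  rewrite ik ltnn mulr1 in xi yi *.
  have -> : y ord0 k + t * (x ord0 k - y ord0 k) - c ord0 k =
    (1 - t) * (y ord0 k - c ord0 k) + t * (x ord0 k - c ord0 k) by ring.
  have -> : A = (1 - t) * A + t * A by ring.
  rewrite (le_trans (ler_normD _ _))// !normrM (ger0_norm t0).
  rewrite (@ger0_norm _ (1 - t)) ?subr_ge0//.
  by rewrite lerD// ler_wpM2l ?subr_ge0.
by have := ler_coord_norm (x - y) k; rewrite !mxE.
Qed.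

(** * Counting grid points in cubes and comparing volumes *)

Lemma card_ord_itv N a w : (a + w <= N)%N -> #|[pred k : 'I_N | (a <= k < a + w)%N]| = w.
Proof.
move=> awN; rewrite cardE size_filter.
rewrite -(count_map (@nat_of_ord N) (fun k => (a <= k < a + w)%N)) -enumT val_enum_ord.
have -> : N = (a + (w + (N - (a + w))))%N by lia.
rewrite !iotaD !count_cat !add0n.
have -> : count (fun k => (a <= k < a + w)%N) (iota 0 a) = 0%N.
  apply/eqP; rewrite -leqn0 leqNgt -has_count; apply/hasPn => k; rewrite mem_iota; lia.
have -> : count (fun k => (a <= k < a + w)%N) (iota (a + w) (N - (a + w))) = 0%N.
  apply/eqP; rewrite -leqn0 leqNgt -has_count; apply/hasPn => k; rewrite mem_iota; lia.
have -> : count (fun k => (a <= k < a + w)%N) (iota a w) = w.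
  by rewrite -[RHS](size_iota a w); apply/eqP; rewrite -all_count; apply/allP => k; rewrite mem_iota.
by rewrite addn0.
Qed.

Lemma card_cube d N a w : (a + w <= N)%N ->
  #|[pred k : {ffun 'I_d -> 'I_N} | [forall i, (a <= k i < a + w)%N]]| = (w ^ d)%N.
Proof.
move=> awN; rewrite -[in RHS](card_ord_itv awN) -[d in RHS]card_ord -card_ffun_on.
apply: eq_card => k; rewrite [LHS]inE; apply/forallP/ffun_onP => H i.
  by rewrite inE; exact: H.
by have := H i; rewrite inE.
Qed.

Lemma ler_natr_dist (R : realType) (a b m : nat) :
  (`|a%:R - b%:R| <= m%:R :> R) = (a <= b + m)%N && (b <= a + m)%N.
Proof.
by rewrite ler_norml lerBlDl lerNl opprB lerBlDl -!natrD !ler_nat andbC.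
Qed.

Lemma ltr_natr_dist (R : realType) (a b m : nat) :
  (`|a%:R - b%:R| < m%:R :> R) = (a < b + m)%N && (b < a + m)%N.
Proof.
by rewrite ltr_norml ltrBlDl ltrNl opprB ltrBlDl -!natrD !ltr_nat andbC.
Qed.

(* Volumes are compared on grids of mesh q / (p2 * l), in which the cube of
   radius q has (2 * p2 * l)^d points and the support of [g] at most (2 * l)^d. *)
Lemma grid_le_cube (R : realType) (d : nat) (c : 'rV[R]_d) (q a : R) (p p2 n : nat)
    (F : nat -> 'rV[R]_d -> R) (g : 'rV[R]_d -> R) :
  0 < q -> (0 < p)%N -> (0 < p2)%N -> (0 < n)%N ->
  (forall k, (k < n)%N -> grid_le c (p%:R * q) (F k) g) ->
  (forall k x, 0 <= F k x) -> (forall x, 0 <= g x <= 1) ->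
  (forall x, q / p2%:R <= `|x - c| -> g x = 0) ->
  (forall x, `|x - c| <= q -> n%:R * a <= \sum_(k < n) F k x) ->
  a * p2%:R ^+ d <= 2.
Proof.
move=> q0 p0 p20 n0 Fg F0 g01 gq Fa.
(* Chosen so that, for [N] as below, the error [e * N%:R ^+ d] is exactly [(2 * l) ^ d], the bound
   for the number of grid points in the support of [g]. *)
pose e : R := ((p * p2)%:R ^+ d)^-1.
have e0 : 0 < e by rewrite invr_gt0 exprn_gt0// ltr0n muln_gt0 p0.
have /choice[N0 HN0] : forall k, exists N0, (k < n)%N -> forall N, (N0 <= N)%N ->
    grid_sum c (p%:R * q) N (F k) <= grid_sum c (p%:R * q) N g + e * N%:R ^+ d.
  move=> k; have [kn|nk] := ltnP k n; last by exists 0%N.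
  by have [m Hm] := Fg k kn e e0; exists m.
(* Large enough for [N] to exceed all the thresholds [N0 k] with [k < n]. *)
pose l := (\max_(k < n) N0 k).+1.
pose N := (2 * (p * (p2 * l)))%N.
have HN k : (k < n)%N -> (N0 k <= N)%N.
  move=> kn; have : (N0 (Ordinal kn) <= \max_(k < n) N0 k)%N by exact: leq_bigmax.
  rewrite /= /N /l; move: (\max_(_ < _) _) => m; nia.
have l0 : (0 < l)%N by [].
have p2l0 : (p2 * l)%:R != 0 :> R by rewrite pnatr_eq0 -lt0n muln_gt0 p20.
have pl0 : (p * (p2 * l))%:R != 0 :> R by rewrite pnatr_eq0 -lt0n !muln_gt0 p0 p20.
pose step : R := q / (p2 * l)%:R.
have step0 : 0 < step by rewrite divr_gt0// ltr0n muln_gt0 p20.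
have gE (k : {ffun 'I_d -> 'I_N}) i : grid_point c (p%:R * q) k ord0 i - c ord0 i =
    step * ((k i)%:R - (p * (p2 * l))%:R).
  rewrite !mxE /step /N; rewrite !natrM in p2l0 pl0 *.
  field. by move: p2l0 pl0; rewrite !mulf_eq0 !negb_or => /andP[-> ->] /andP[-> _].
have sums : \sum_(k < n) grid_sum c (p%:R * q) N (F k) <=
    n%:R * (grid_sum c (p%:R * q) N g + e * N%:R ^+ d).
  apply: (@le_trans _ _ (\sum_(k < n) (grid_sum c (p%:R * q) N g + e * N%:R ^+ d))).
    by apply: ler_sum => k _; apply: HN0 => //; exact: HN.
  by rewrite sumr_const card_ord -[leLHS]mulr_natl.
have low : n%:R * a * ((2 * (p2 * l)) ^ d)%N%:R <= \sum_(k < n) grid_sum c (p%:R * q) N (F k).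
  rewrite exchange_big /=.
  pose Q := [pred k : {ffun 'I_d -> 'I_N} | [forall i,
    ((p * (p2 * l) - p2 * l) <= k i < (p * (p2 * l) - p2 * l) + 2 * (p2 * l))%N]].
  have cQ : #|Q| = ((2 * (p2 * l)) ^ d)%N.
    by apply: card_cube; rewrite /N; nia.
  rewrite (bigID (mem Q)) /= -cQ mulr_natr -sumr_const.
  rewrite -[leLHS]addr0 lerD//; last first.
    by apply: sumr_ge0 => k _; apply: sumr_ge0.
  apply: ler_sum => k kQ; apply: Fa; apply: ler_norm_coord => [|i]; first exact: ltW.
  move: kQ; rewrite inE => /forallP/(_ i) /andP[k1 k2].
  have plp : (p2 * l <= p * (p2 * l))%N by rewrite leq_pmull.
  rewrite mxE [(- c) _ _]mxE gE normrM gtr0_norm// /step -mulrA ler_piMr ?(ltW q0)//.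
  rewrite mulrC ler_pdivrMr ?mul1r; last by rewrite ltr0n muln_gt0 p20.
  by rewrite ler_natr_dist; apply/andP; split; lia.
(* The [2 * l] indices per axis run from [l] below the central one to [l - 1] above it. The next
   index lies at distance exactly [q / p2%:R], where [g] already vanishes. *)
have up : grid_sum c (p%:R * q) N g <= ((2 * l) ^ d)%N%:R.
  pose Q := [pred k : {ffun 'I_d -> 'I_N} | [forall i,
    ((p * (p2 * l) - l) <= k i < (p * (p2 * l) - l) + 2 * l)%N]].
  have plp : (l <= p * (p2 * l))%N by rewrite mulnA leq_pmull// muln_gt0 p0.
  have cQ : #|Q| = ((2 * l) ^ d)%N by apply: card_cube; rewrite /N; lia.
  rewrite -cQ -sumr_const /grid_sum (bigID (mem Q)) /= [X in _ + X]big1 ?addr0.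
    by apply: ler_sum => k _; have /andP[] := g01 (grid_point c (p%:R * q) k).
  move=> k; rewrite inE negb_forall => /existsP[i ki]; apply: gq.
  apply: le_trans (ler_coord_norm _ i); rewrite mxE [(- c) _ _]mxE gE normrM gtr0_norm//.
  have -> : q / p2%:R = step * l%:R.
    rewrite /step natrM; field.
    by move: p2l0; rewrite natrM mulf_eq0 negb_or andbC.
  rewrite ler_pM2l// leNgt ltr_natr_dist; apply/negP => /andP[h1 h2].
  by move/negP: ki; apply; apply/andP; split; lia.
(* Main term and error term are both at most [(2 * l) ^ d], which gives the constant 2 after
   division. *)
have {low sums up} H := le_trans low (le_trans sums (ler_wpM2l (ler0n _ n) (lerD up (lexx _)))).
move: H; rewrite -mulrA ler_pM2l ?ltr0n//.
have -> : e * N%:R ^+ d = ((2 * l) ^ d)%N%:R.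
  have -> : N = ((p * p2) * (2 * l))%N by rewrite /N; lia.
  rewrite [(_ * (2 * l))%:R]natrM exprMn mulrA mulVf ?mul1r ?natrX//.
  by rewrite expf_neq0// pnatr_eq0 -lt0n muln_gt0 p0.
have -> : (2 * (p2 * l) = p2 * (2 * l))%N by lia.
rewrite expnMn natrM natrX mulrA -[X in _ <= X]mulr2n -[X in _ <= X]mulr_natl ler_pM2r//.
by rewrite ltr0n expn_gt0.
Qed.

(** * Discrete orbits compared with trajectories *)

Lemma is_derive_coord (R : realType) (d : nat) (Y : R -> 'rV[R]_d) (t : R) (w : 'rV[R]_d) j :
  is_derive t 1 Y w -> is_derive t 1 (fun s => Y s ord0 j) (w ord0 j).
Proof.
move=> [dY <-]; apply: DeriveDef; first by move/derivable_mxP : dY.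
by rewrite derive_mx// mxE.
Qed.

Section orbit.
Context (R : realType) (d : nat).
Notation E := 'rV[R]_d.
Variables (c : E) (A : R) (b : 'I_d -> E -> R) (tau M L M1 T : R).
Hypothesis tau0 : 0 < tau.
Hypothesis db : forall i j x, derivable (b i) x (ev R j).
Hypothesis M0 : 0 < M.
Hypothesis L0 : 0 < L.
Hypothesis bM : forall i x, `|x - c| <= A -> `|b i x| <= M.
Hypothesis bL : forall i x y, `|x - c| <= A -> `|y - c| <= A ->
  `|b i x - b i y| <= L * `|x - y|.
Hypothesis dbM : forall i x, `|x - c| <= A -> `|pd i (b i) x| <= M1.
Hypothesis tauM1 : tau * M1 <= 1 / 2.

(* Bound for the distance between the discrete orbit and the trajectory up to time [T]. *)
Let err : R := tau * (d.+1%:R * M) * expR (L * T).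
Hypothesis err2 : err <= 1 / 2.

Variables (Y : R -> E) (x : E).
Hypothesis Y0 : Y 0 = x.
Hypothesis dY : forall t : R, 0 <= t -> is_derive t 1 Y (\row_i b i (Y t)).
Hypothesis YA : forall t, 0 <= t -> `|Y t - c| <= A - 2.

Let s := enum 'I_d.

Definition orbit (k : nat) : E := iter k (act b tau s) x.

Let YA' t : 0 <= t -> `|Y t - c| <= A. Proof. by move=> /YA; lra. Qed.

Lemma trajectory_dist t u : 0 <= t -> t <= u -> `|Y u - Y t| <= M * (u - t).
Proof.
move=> t0 tu; apply: ler_norm_coord => [|j]; first by rewrite mulr_ge0 ?subr_ge0// ltW.
have [|z /andP[tz zu]] := @mean_value R (fun s => Y s ord0 j)
  (fun s => (\row_i b i (Y s)) ord0 j) _ _ tu.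
  by move=> z /andP[tz _]; apply: is_derive_coord; apply: dY; exact: le_trans tz.
have z0 : 0 <= z by exact: le_trans tz.
by rewrite !mxE => ->; rewrite normrM (@ger0_norm _ (u - t)) ?subr_ge0// ler_wpM2r ?subr_ge0// bM ?YA'.
Qed.

Lemma trajectory_step_dist t : 0 <= t ->
  `|Y (t + tau) - Y t - tau *: \row_i b i (Y t)| <= tau * (L * (M * tau)).
Proof.
move=> t0; apply: ler_norm_coord => [|j]; first by rewrite !mulr_ge0// ltW.
have tt : t <= t + tau by rewrite lerDl ltW.
have [|z /andP[tz zu]] := @mean_value R (fun s => Y s ord0 j)
  (fun s => (\row_i b i (Y s)) ord0 j) _ _ tt.
  by move=> z /andP[tz _]; apply: is_derive_coord; apply: dY; exact: le_trans tz.
have z0 : 0 <= z by exact: le_trans tz.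
have YzA := YA' z0; have YtA := YA' t0.
rewrite !mxE => ->; rewrite addrAC subrr add0r mulrC -mulrBr normrM (gtr0_norm tau0).
rewrite ler_pM2l// (le_trans (bL _ YzA YtA))// ler_pM2l//.
rewrite (le_trans (trajectory_dist t0 tz))// ler_pM2l//; lra.
Qed.

Let dM0 : 0 < tau * (d.+1%:R * M). Proof. by rewrite !mulr_gt0// ltr0n. Qed.

Let growth_le k : k%:R * tau <= T -> (1 + L * tau) ^+ k <= expR (L * T).
Proof.
move=> kT; have h : 1 + L * tau <= expR (L * tau) by exact: expR_ge1Dx.
have h0 : 0 <= 1 + L * tau by rewrite addr_ge0// mulr_ge0// ltW.
apply: (@le_trans _ _ (expR (L * tau) ^+ k)).
  by rewrite lerXn2r ?nnegrE// expR_ge0.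
rewrite -expRM_natl ler_expR mulrCA ler_pM2l//.
Qed.

Let err_ge : 0 <= T -> tau * (d.+1%:R * M) <= err.
Proof.
move=> T0; rewrite /err ler_peMr ?(ltW dM0)//.
by rewrite -expR0 ler_expR mulr_ge0// ltW.
Qed.

(** Discrete Gronwall estimate. The geometric bound is the one that propagates by induction; the
    uniform bound [err] keeps the orbit inside the cube, where the next step can be estimated. *)
Lemma orbit_dist k : k%:R * tau <= T ->
  `|orbit k - Y (k%:R * tau)| <= tau * (d.+1%:R * M) * ((1 + L * tau) ^+ k - 1)
  /\ `|orbit k - Y (k%:R * tau)| <= err.
Proof.
have weak j : j%:R * tau <= T ->
    `|orbit j - Y (j%:R * tau)| <= tau * (d.+1%:R * M) * ((1 + L * tau) ^+ j - 1) ->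
    `|orbit j - Y (j%:R * tau)| <= err.
  move=> jT h; apply: le_trans h _; rewrite /err ler_pM2l//.
  by have := growth_le jT; lra.
elim: k => [|k IH] kT.
  have h : `|orbit 0 - Y (0 * tau)| <= tau * (d.+1%:R * M) * ((1 + L * tau) ^+ 0 - 1).
    by rewrite /orbit /= mul0r Y0 !subrr normr0 mulr0.
  by split; [exact: h|exact: weak h].
have T0 : 0 <= T by apply: le_trans kT; rewrite mulr_ge0// ltW.
have kE : k.+1%:R * tau = k%:R * tau + tau by rewrite -[k.+1]addn1 natrD; ring.
have {}kT' : k%:R * tau <= T by apply: le_trans kT; rewrite kE lerDl ltW.
have [IH1 IH2] := IH kT'.
have kt0 : 0 <= k%:R * tau by rewrite mulr_ge0// ltW.
set y := Y (k%:R * tau) in IH1 IH2.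
have yA := YA kt0; rewrite -/y in yA.
have oA : `|orbit k - c| <= `|orbit k - y| + `|y - c|.
  by rewrite -[orbit k - c](subrKA y) ler_normD.
have errT := err_ge T0.
have h1 : `|orbit k.+1 - orbit k - tau *: \row_j b j (orbit k)| <=
    tau * (L * (d%:R * (tau * M))).
  apply: (@act_step_dist R d c A b tau tau0 M L M0 L0 bM bL).
  have -> : d.+1%:R * (tau * M) = tau * (d.+1%:R * M) by rewrite mulrCA.
  have := err2; lra.
have h2 := trajectory_step_dist kt0; rewrite -/y -kE in h2.
have h3 : `|tau *: (\row_j b j (orbit k) - \row_j b j y)| <= tau * (L * `|orbit k - y|).
  rewrite normrZ gtr0_norm// ler_pM2l//; apply: ler_norm_coord => [|j].
    by rewrite mulr_ge0// ltW.
  by rewrite !mxE; apply: bL; have := err2; lra.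
have h : `|orbit k.+1 - Y (k.+1%:R * tau)| <=
    tau * (d.+1%:R * M) * ((1 + L * tau) ^+ k.+1 - 1).
  have -> : orbit k.+1 - Y (k.+1%:R * tau) =
      (orbit k.+1 - orbit k - tau *: \row_j b j (orbit k))
      - (Y (k.+1%:R * tau) - y - tau *: \row_i b i y)
      + tau *: (\row_j b j (orbit k) - \row_j b j y) + (orbit k - y).
    have aux (o1 y1 o y' u1 u2 : E) :
        o1 - y1 = (o1 - o - u1) - (y1 - y' - u2) + (u1 - u2) + (o - y').
      by apply/rowP => j; rewrite !mxE; ring.
    by rewrite scalerBr; exact: aux.
  apply: le_trans (ler_normD _ _) _; apply: le_trans (lerD (ler_normD _ _) (lexx _)) _.
  apply: le_trans (lerD (lerD (ler_normB _ _) (lexx _)) (lexx _)) _.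
  apply: le_trans (lerD (lerD (lerD h1 h2) h3) (lexx _)) _.
  rewrite exprS.
  (* The local errors of the [d] shears and of the trajectory add up to [L * tau] times
     [tau * (d.+1%:R * M)], exactly what the geometric bound absorbs in one step. *)
  have -> : tau * (d.+1%:R * M) * ((1 + L * tau) * (1 + L * tau) ^+ k - 1) =
    (1 + L * tau) * (tau * (d.+1%:R * M) * ((1 + L * tau) ^+ k - 1))
    + tau * (L * (d%:R * (tau * M))) + tau * (L * (M * tau)).
    by rewrite -[d.+1]addn1 natrD; ring.
  have h4 : (1 + L * tau) * `|orbit k - y| <=
      (1 + L * tau) * (tau * (d.+1%:R * M) * ((1 + L * tau) ^+ k - 1)).
    by apply: ler_wpM2l => //; rewrite addr_ge0// mulr_ge0// ltW.
  lra.
by split; [exact: h|exact: weak h].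
Qed.

(** The trajectory stays within [A - 2]; the orbit deviates from it by at most [err], the
    displacement term is at most [err] too, and [err <= 1 / 2]. *)
Lemma orbit_cball k : k%:R * tau <= T ->
  `|orbit k - c| + d.+1%:R * (tau * M) <= A - 1.
Proof.
move=> kT; have [_ h] := orbit_dist kT.
have kt0 : 0 <= k%:R * tau by rewrite mulr_ge0// ltW.
have T0 := le_trans kt0 kT.
have oA : `|orbit k - c| <= `|orbit k - Y (k%:R * tau)| + `|Y (k%:R * tau) - c|.
  by rewrite -[orbit k - c](subrKA (Y (k%:R * tau))) ler_normD.
have -> : d.+1%:R * (tau * M) = tau * (d.+1%:R * M) by rewrite mulrCA.
have := YA kt0; have := err_ge T0; have := err2; lra.
Qed.

Lemma iter_pulls_act f k (z : E) :
  (forall j, (j < k)%N -> `|iter j (act b tau s) z - c| + d.+1%:R * (tau * M) <= A - 1) ->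
  iter k (pulls c A b tau s) f z =
    f (iter k (act b tau s) z) * \prod_(j < k) weight b tau s (iter j (act b tau s) z).
Proof.
elim: k z => [|k IH] z H; first by rewrite big_ord0 mulr1.
rewrite iterS (@pulls_step R d c A b tau tau0 M M0 bM z (H 0%N isT)) -/s IH; last first.
  by move=> j jk; rewrite -iterSr; exact: H.
rewrite -iterSr big_ord_recl /= -mulrA; congr (_ * _); rewrite mulrC; congr (_ * _).
by apply: eq_bigr => j _; rewrite -iterSr.
Qed.

Lemma iter_pulls_orbit f k : k%:R * tau <= T ->
  iter k (pulls c A b tau s) f x = f (orbit k) * \prod_(j < k) weight b tau s (orbit j).
Proof.
move=> kT; apply: iter_pulls_act => j jk; apply: orbit_cball.
by apply: le_trans kT; rewrite ler_pM2r// ler_nat ltnW.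
Qed.

(** Summing [potential_step_ge] bounds the accumulated squared speed by the variation of [v], hence
    the time the orbit can spend where the field is not small. *)
Lemma orbit_potential_le (v : E -> R) n :
  (forall i y, is_derive y (ev R i) v (b i y)) -> n%:R * tau <= T ->
  tau * \sum_(k < n) \sum_i (b i (orbit k)) ^+ 2 <=
  v (orbit n) - v x + n%:R * tau * (d%:R * (2 * L * M * (d.+1%:R * (tau * M)))).
Proof.
move=> dv; elim: n => [|n IH] nT.
  by rewrite big_ord0 mulr0 /orbit /= subrr !mul0r addr0.
have nE : n.+1%:R * tau = n%:R * tau + tau by rewrite -[n.+1]addn1 natrD; ring.
have nT' : n%:R * tau <= T by apply: le_trans nT; rewrite nE lerDl ltW.
have := @potential_step_ge R d c A b tau tau0 M L M0 L0 bM bL (orbit n) (orbit_cball nT') v dv.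
rewrite -/s -[act _ _ _ _]/(orbit n.+1).
have -> : d%:R * (tau * M) + tau * M = d.+1%:R * (tau * M).
  by rewrite -[d.+1]addn1 natrD; ring.
move: (IH nT'); rewrite big_ord_recr /= nE; set S := \sum_(i < n) _; set S' := \sum_i _.
lra.
Qed.

(** On each time step the increment of [D] is [tau] times the divergence at some [Y u], by the mean
    value theorem. The modulus of continuity transfers this value to the points visited by the
    shears, with loss [delta] per axis. *)
Lemma orbit_weight_ge (D : R -> R) (delta r : R) n :
  (forall i z y, `|z - c| <= A -> `|y - z| < r ->
     `|pd i (b i) y - pd i (b i) z| < delta) ->
  2 * err < r -> n%:R * tau <= T ->
  (forall t : R, 0 <= t <= T -> is_derive t 1 D (\sum_i pd i (b i) (Y t))) ->
  expR (D (n%:R * tau) - D 0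
    - n%:R * tau * (d%:R * delta) - n%:R * (d%:R * (2 * (tau * M1) ^+ 2)))
  <= \prod_(j < n) weight b tau s (orbit j).
Proof.
move=> Hmod err_r + dD; elim: n => [|n IH] nT.
  by rewrite big_ord0 !mul0r subrr !subr0 expR0.
have nE : n.+1%:R * tau = n%:R * tau + tau by rewrite -[n.+1]addn1 natrD; ring.
have nT' : n%:R * tau <= T by apply: le_trans nT; rewrite nE lerDl ltW.
have nt0 : 0 <= n%:R * tau by rewrite mulr_ge0// ltW.
have T0 := le_trans nt0 nT'.
rewrite big_ord_recr /=.
have le_n : n%:R * tau <= n.+1%:R * tau by rewrite nE lerDl ltW.
have [|u /andP[nu un] Du] := @mean_value R D (fun t => \sum_i pd i (b i) (Y t)) _ _ le_n.
  move=> t /andP[nt tn]; apply: dD.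
  by rewrite (le_trans nt0 nt) (le_trans tn nT).
have u0 : 0 <= u by exact: le_trans nu.
have [_ on] := orbit_dist nT'.
have Yu : `|Y u - Y (n%:R * tau)| <= M * tau.
  by rewrite (le_trans (trajectory_dist nt0 nu))// ler_pM2l//; lra.
have := @weight_step_ge R d c A b tau tau0 M M1 M0 bM dbM tauM1 (orbit n) (orbit_cball nT')
  (fun i => pd i (b i) (Y u) - delta).
have -> : (\sum_(i < d) (pd i (b i) (Y u) - delta)) = \sum_i pd i (b i) (Y u) - d%:R * delta.
  by rewrite sumrB sumr_const card_ord -[delta *+ d]mulr_natl.
rewrite -/s => W.
have {}W := W _; apply: le_trans (ler_pM _ _ (IH nT') (W _)); rewrite ?expR_ge0//.
  rewrite -expRD ler_expR; move: Du; rewrite nE => Du.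
  have -> : n.+1%:R = n%:R + 1 :> R by rewrite -[n.+1]addn1 natrD.
  have -> : D (n%:R * tau + tau) = (\sum_i pd i (b i) (Y u)) * tau + D (n%:R * tau).
    by have := Du; rewrite addrAC subrr add0r => <-; ring.
  lra.
move=> i z zn.
have h1 : `|z - Y u| <= `|z - orbit n| + `|orbit n - Y (n%:R * tau)| + `|Y u - Y (n%:R * tau)|.
  rewrite [`|Y u - _|]distrC.
  have -> : z - Y u = (z - orbit n) + (orbit n - Y (n%:R * tau)) + (Y (n%:R * tau) - Y u).
    by rewrite !subrKA.
  by rewrite (le_trans (ler_normD _ _))// lerD2r ler_normD.
(* The trace contributes [d%:R * (tau * M)] and the motion from [Y (n%:R * tau)] to [Y u] another
   [M * tau], together at most [err]; the orbit error is a second [err]. *)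
have h2 : `|z - Y u| < r.
  have := err_ge T0; rewrite -[d.+1]addn1 natrD; lra.
by have := Hmod i _ _ (YA' u0) h2; rewrite ltr_norml; lra.
Qed.

End orbit.

(** * Choice of the step size, the test function, and a lower bound for the field *)

Lemma near0_div (R : realType) (P : R -> Prop) (T : R) : 0 < T ->
  (\forall t \near 0^'+, P t) -> exists n : nat, (0 < n)%N /\ P (T / n%:R).
Proof.
move=> T0 [e /= e0 H].
exists (Num.truncn (T / e)).+1; split=> //.
have n0 : 0 < T / (Num.truncn (T / e)).+1%:R by rewrite divr_gt0.
apply: H => //=; rewrite sub0r normrN gtr0_norm// ltr_pdivrMr// [e * _]mulrC -ltr_pdivrMr//.
exact: truncnS_gt.
Qed.

Lemma near0_mul_lt (R : realType) (a e : R) : 0 < e -> \forall t \near 0^'+, t * a < e.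
Proof.
move=> e0; near=> t.
have t0 : 0 < t by [].
have : t < e / (`|a| + 1) by near: t; apply: nbhs_right_lt; rewrite divr_gt0// ltr_wpDl.
rewrite ltr_pdivlMr ?ltr_wpDl// mulrDr mulr1 => H.
have : t * a <= t * `|a| by rewrite ler_pM2l// ler_norm.
lra.
Unshelve. all: by end_near. Qed.

Section tent.
Context (R : realType) (d : nat) (c : 'rV[R]_d) (rho : R).
Hypothesis rho0 : 0 < rho.

Definition tent (y : 'rV[R]_d) : R := Num.max 0 (1 - `|y - c| / rho).

Lemma tent_itv y : 0 <= tent y <= 1.
Proof.
by rewrite /tent le_max lexx /= ge_max ler01 gerBl divr_ge0// ltW.
Qed.

Lemma tent_eq0 y : rho <= `|y - c| -> tent y = 0.
Proof.
by move=> h; apply/max_idPl; rewrite subr_le0 ler_pdivlMr// mul1r.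
Qed.

Lemma tent_ge y : 1 - `|y - c| / rho <= tent y.
Proof. by rewrite /tent le_max lexx orbT. Qed.

Lemma tent_lipschitz y z : tent y - `|y - z| / rho <= tent z.
Proof.
rewrite {1}/tent lerBlDr ge_max; apply/andP; split.
  by rewrite addr_ge0 ?divr_ge0 ?(ltW rho0)//; have /andP[] := tent_itv z.
have : `|z - c| / rho <= (`|y - z| + `|y - c|) / rho.
  rewrite ler_pM2r ?invr_gt0// [`|y - z|]distrC.
  by rewrite -[z - c](subrKA y) ler_normD.
have := tent_ge z; lra.
Qed.

Lemma continuous_tent : continuous tent.
Proof.
move=> y.
have h1 := @continuous_dist R _ c.
have h4 : {for y, continuous (fun _ : 'rV[R]_d => 0 : R)} by exact: cst_continuous.
have h5 : {for y, continuous (fun _ : 'rV[R]_d => rho^-1)} by exact: cst_continuous.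
have h6 : {for y, continuous (fun _ : 'rV[R]_d => 1 : R)} by exact: cst_continuous.
exact: (continuous_max h4 (continuousB h6 (continuousM (h1 y) h5))).
Qed.

End tent.

Lemma continuous_sumr (R : realType) (V : topologicalType) (I : finType)
    (f : I -> V -> R) : (forall i, continuous (f i)) ->
  continuous (fun x => \sum_i f i x).
Proof. by move=> cf; apply: continuous_big => //; exact: add_continuous. Qed.

Lemma continuous_sum_sqr (R : realType) (V : topologicalType) (I : finType)
    (f : I -> V -> R) : (forall i, continuous (f i)) ->
  continuous (fun x => \sum_i (f i x) ^+ 2).
Proof.
move=> cf; apply: (@continuous_sumr R V I (fun i x => f i x ^+ 2)) => i x.
exact: (continuousM (@cf i x) (@cf i x)).
Qed.

Lemma compact_nonzero_lower_bound (R : realType) (V : normedModType R) (I : finType)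
    (K : set V) (c : V) (f : I -> V -> R) rho :
  compact K -> (forall i, continuous (f i)) -> 0 < rho ->
  (forall y, K y -> (forall i, f i y = 0) -> y = c) ->
  exists2 m, 0 < m & forall y, K y -> rho <= `|y - c| -> m <= \sum_i (f i y) ^+ 2.
Proof.
move=> cK cf rho0 Kc.
pose K' := K `&` [set y | rho <= `|y - c|].
have cK' : compact K'.
  apply: compact_closedI => //.
  have -> : [set y | rho <= `|y - c|] = (fun y => `|y - c|) @^-1` [set r | rho <= r] by [].
  apply: preimage_closed; last exact: closed_ge.
  by move=> x _; exact: continuous_dist.
have [K0|/set0P/negP] := pselect (K' !=set0); last first.
  rewrite negbK => /eqP K0; exists 1 => // y Ky yc.
  by have : K' y by []; rewrite K0.
have [z + zm] := compact_EVT_min K0 cK' (continuous_subspaceT (continuous_sum_sqr cf)).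
rewrite inE => -[Kz /= zc].
exists (\sum_i (f i z) ^+ 2) => [|y Ky yc]; last by apply: zm; rewrite inE.
rewrite lt0r sumr_ge0 ?andbT; last by move=> i _; exact: sqr_ge0.
apply/negP => /eqP; move/psumr_eq0P => H.
have zE : z = c.
  apply: Kc => // i; have /eqP := H (fun i _ => sqr_ge0 _) i isT.
  by rewrite sqrf_eq0 => /eqP.
by move: zc; rewrite zE subrr normr0 leNgt rho0.
Qed.

(** * Contradiction for a gradient flow with bounded distortion *)

Section bounded_distortion.
Context (R : realType) (d : nat).
Notation E := 'rV[R]_d.
Variables (c : E) (K : set E) (b : 'I_d -> E -> R) (v : E -> R) (q C : R) (Y : E -> R -> E).
Hypothesis d0 : (0 < d)%N.
Hypothesis q0 : 0 < q.
Hypothesis cK : compact K.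
Hypothesis Kc : forall y, K y -> (forall i, b i y = 0) -> y = c.
Hypothesis db : forall i j x, derivable (b i) x (ev R j).
Hypothesis cb : forall i, continuous (b i).
Hypothesis cdb : forall i j, continuous (pd j (b i)).
Hypothesis dv : forall i y, is_derive y (ev R i) v (b i y).
Hypothesis Y0 : forall x, `|x - c| <= q -> Y x 0 = x.
Hypothesis dY : forall x (t : R), `|x - c| <= q -> 0 <= t ->
  is_derive t 1 (Y x) (\row_i b i (Y x t)).
Hypothesis YK : forall x t, `|x - c| <= q -> 0 <= t -> K (Y x t).
Hypothesis Ydiv : forall x T, `|x - c| <= q -> 0 <= T -> exists D : R -> R,
  (forall t : R, 0 <= t <= T -> is_derive t 1 D (\sum_i pd i (b i) (Y x t))) /\
  (forall t, 0 <= t <= T -> - C <= D t - D 0).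

(** Pull-backs of one narrow tent under the discrete flow have grid sums at most that of the tent,
    asymptotically. Yet their average over the time steps is at least [expR (- C - 1) / 2] on the
    cube of radius [q], which [grid_le_cube] forbids once the tent is narrow enough. *)
Lemma gradient_flow_not_bounded_distortion : False.
Proof.
have [R0 R00 KR0'] := compact_norm_bound cK (@continuous_dist R _ c).
have KR0 y : K y -> `|y - c| <= R0 by move=> /KR0'; rewrite normr_id.
(* [A] is an integer multiple of [q] so that the grids fit the cube of radius [q]; exceeding
   [R0 + 2] leaves the trajectories the margin 2. *)
pose p := (Num.truncn ((R0 + 2) / q)).+1.
pose A := p%:R * q.
have pA : R0 + 2 < A.
  by rewrite /A -ltr_pdivrMr//; exact: truncnS_gt.
have A0 : 0 < A by lra.
pose B := [set x : E | `|x - c| <= A].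
have cB : compact B := compact_cball (c := c) (r := A).
have [M M0 bM] := compact_norm_bound_fin cB cb.
have [M1 M10 dbM] := compact_norm_bound_fin (I := ('I_d * 'I_d)%type)
  (f := fun ij => pd ij.2 (b ij.1)) cB (fun ij => @cdb ij.1 ij.2).
pose L := d%:R * M1.
have L0 : 0 < L by rewrite mulr_gt0// ltr0n.
have dR0 : 0 < d%:R :> R by rewrite ltr0n.
have bL i x y : `|x - c| <= A -> `|y - c| <= A -> `|b i x - b i y| <= L * `|x - y|.
  apply: lipschitz_cball; [exact: ltW|by move=> j z; exact: db|].
  by move=> j z zA; exact: (dbM (i, j)).
have vL x y : `|x - c| <= A -> `|y - c| <= A -> `|v x - v y| <= d%:R * M * `|x - y|.
  apply: lipschitz_cball; [exact: ltW|by move=> j z; have [] := dv j z|].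
  by move=> j z zA; rewrite /pd; have [_ ->] := dv j z; exact: bM.
(* The final count gives [p2%:R ^+ d <= 4 * expR (C + 1)], which this choice contradicts because [d]
   is positive. *)
pose p2 := (Num.truncn (4 * expR (C + 1))).+1.
have p2C : 4 * expR (C + 1) < p2%:R by exact: truncnS_gt.
have p20 : 0 < p2%:R :> R by rewrite ltr0n.
pose rho := q / p2%:R.
have rho0 : 0 < rho by rewrite divr_gt0.
have rho4 : 0 < rho / 4 by rewrite divr_gt0.
have [m m0 Hm] := compact_nonzero_lower_bound cK cb rho4 Kc.
(* The variation of [v] on the cube is at most [d%:R * M * (2 * A)], and this equals
   [T * m / 12]. *)
pose T := 24 * (d%:R * M * A) / m.
have T0 : 0 < T by rewrite divr_gt0// !mulr_gt0.
pose delta := (2 * d%:R * T)^-1.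
have delta0 : 0 < delta by rewrite invr_gt0 mulr_gt0// mulr_gt0.
have [r r0 Hr] := compact_uniform_modulus_fin cB (fun i => @cdb i i) delta0.
pose kappa := d.+1%:R * M * expR (L * T).
have kappa0 : 0 < kappa by rewrite mulr_gt0 ?expR_gt0// mulr_gt0// ltr0n.
have twelve : 0 < 1 / 12 :> R by [].
have half : 0 < 1 / 2 :> R by [].
(* In order: Jacobians stay positive; [err] is at most 1/2; [2 * err] is below the modulus [r]; then
   the discretization errors of the potential and of the tent, and the quadratic loss in the
   Jacobians. *)
pose small t := [/\ t * M1 < 1 / 2, t * kappa < 1 / 2, t * (2 * kappa) < r &
  [/\ t * (d%:R * (2 * L * M * (d.+1%:R * M)) / m) < 1 / 12,
    t * (kappa * (d%:R * (2 * M * L) / m + rho^-1)) < 1 / 12 &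
    t * (T * d%:R * (2 * M1 ^+ 2)) < 1 / 2]].
(* The step is taken of the form [T / n%:R], so that [n] steps reach time [T] exactly. *)
have [|n [n0 [Hn1 Hn2 Hn3 [Hn4 Hn5 Hn6]]]] := @near0_div R small T T0.
  by near=> t; do 2?split; near: t; exact: near0_mul_lt.
set tau := T / n%:R in Hn1 Hn2 Hn3 Hn4 Hn5 Hn6.
have nR0 : 0 < n%:R :> R by rewrite ltr0n.
have tau0 : 0 < tau by rewrite divr_gt0.
have ntau : n%:R * tau = T by rewrite /tau mulrC divfK ?gt_eqF.
pose s := enum 'I_d.
have tauM1 : tau * M1 <= 1 / 2 by exact: ltW.
have dbM' i x : `|x - c| <= A -> `|pd i (b i) x| <= M1 by exact: (dbM (i, i)).
pose err := tau * (d.+1%:R * M) * expR (L * T).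
have errE : err = tau * kappa by rewrite /err /kappa; ring.
have err2 : err <= 1 / 2 by rewrite errE ltW.
have YA x t : `|x - c| <= q -> 0 <= t -> `|Y x t - c| <= A - 2.
  by move=> xq t0; have := KR0 _ (YK xq t0); lra.
have jac0 i x : `|x - c| <= A -> 0 <= jac b tau i x.
  move=> xA; have : `|tau * pd i (b i) x| <= 1 / 2.
    by rewrite normrM gtr0_norm// (le_trans _ tauM1)// ler_pM2l// dbM'.
  by rewrite /jac ler_norml; lra.
have bt : bump c A (tent c rho).
  split; first exact: continuous_tent.
    by move=> x; have /andP[] := tent_itv c rho0 x.
  move=> x Ax; apply: tent_eq0 => //; apply: le_trans Ax.
  rewrite /rho /A mulrC ler_wpM2r ?(ltW q0)//.
  have h1 : 1 <= p%:R :> R by rewrite ler1n.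
  have h2 : p2%:R^-1 <= 1 :> R by rewrite invf_le1// ler1n.
  exact: le_trans h2 h1.
pose F k := iter k (pulls c A b tau s) (tent c rho).
have avg x : `|x - c| <= q -> n%:R * (expR (- C - 1) / 2) <= \sum_(k < n) F k x.
  move=> xq.
  pose z := orbit b tau x; pose y k := Y x (k%:R * tau).
  have kT k : (k <= n)%N -> k%:R * tau <= T by move=> kn; rewrite -ntau ler_pM2r// ler_nat.
  have kt0 k : 0 <= k%:R * tau by rewrite mulr_ge0// ltW.
  have dYx (t : R) : 0 <= t -> is_derive t 1 (Y x) (\row_i b i (Y x t)) by exact: dY.
  have YAx t : 0 <= t -> `|Y x t - c| <= A - 2 by exact: YA.
  (* The exponent loses [C] by the hypothesis on [D], 1/2 through [delta] and 1/2 through the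
     quadratic Jacobian terms. *)
  have xF k : (k < n)%N -> expR (- C - 1) * tent c rho (z k) <= F k x.
    move=> kn; have kT' := kT _ (ltnW kn).
    rewrite /F (iter_pulls_orbit tau0 M0 L0 bM bL err2 (Y0 xq) dYx YAx (tent c rho) kT').
    rewrite mulrC ler_wpM2l//; first by have /andP[] := tent_itv c rho0 (z k).
    have [D [dD CD]] := Ydiv xq (ltW T0).
    have err_r : 2 * err < r by rewrite errE mulrCA.
    apply: le_trans (orbit_weight_ge tau0 M0 L0 bM bL dbM' tauM1 err2 (Y0 xq)
      dYx YAx Hr err_r kT' dD).
    rewrite ler_expR.
    have h1 : - C <= D (k%:R * tau) - D 0 by apply: CD; rewrite kt0 kT'.
    have h2 : k%:R * tau * (d%:R * delta) <= 1 / 2.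
      have -> : 1 / 2 = T * (d%:R * delta) by rewrite /delta; field; rewrite !gt_eqF.
      by rewrite ler_pM2r// mulr_gt0.
    have h3 : k%:R * (d%:R * (2 * (tau * M1) ^+ 2)) <= 1 / 2.
      have -> : k%:R * (d%:R * (2 * (tau * M1) ^+ 2)) =
        tau * ((k%:R * tau) * d%:R * (2 * M1 ^+ 2)) by ring.
      apply: le_trans (ltW Hn6); rewrite ler_pM2l// ler_pM2r; last by rewrite mulr_gt0// exprn_gt0.
      by rewrite ler_pM2r.
    lra.
  have tentk k : (k < n)%N -> 3 / 4 - (d%:R * (2 * M * L) / m + rho^-1) * err
      - (\sum_i b i (z k) ^+ 2) / m <= tent c rho (z k).
    move=> kn; have kT' := kT _ (ltnW kn).
    have [_ oy] := orbit_dist tau0 M0 L0 bM bL err2 (Y0 xq) dYx YAx kT'.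
    rewrite -/(z k) -/(y k) -/err in oy.
    have yA : `|y k - c| <= A by have := YAx _ (kt0 k); rewrite -/(y k); lra.
    have oA : `|z k - c| <= A.
      have := orbit_cball tau0 M0 L0 bM bL err2 (Y0 xq) dYx YAx kT'.
      have : 0 <= d.+1%:R * (tau * M) by rewrite mulr_ge0// mulr_ge0// ltW.
      rewrite -/(z k); lra.
    have sq : \sum_i b i (y k) ^+ 2 <= \sum_i b i (z k) ^+ 2 + d%:R * (2 * M * L) * err.
      have -> : d%:R * (2 * M * L) * err = \sum_(i < d) (2 * M * L * err).
        by rewrite sumr_const card_ord -[RHS]mulr_natl; ring.
      rewrite -big_split /=; apply: ler_sum => i _; rewrite -lerBlDl subr_sqr.
      apply: le_trans (ler_norm _) _; rewrite normrM.
      have -> : 2 * M * L * err = (L * err) * (M + M) by ring.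
      apply: ler_pM => //.
        by rewrite (le_trans (bL i _ _ yA oA))// ler_pM2l// distrC.
      by rewrite (le_trans (ler_normD _ _))// lerD// bM.
    (* Within [rho / 4] of [c] the tent is at least 3/4; farther away the subtracted quotient is at
       least 1 and the left side is negative. The bound [m] holds only on [K], hence the detour
       through the trajectory point [y k]. *)
    have ty : 3 / 4 - (\sum_i b i (y k) ^+ 2) / m <= tent c rho (y k).
      have S0 : 0 <= \sum_i b i (y k) ^+ 2 by apply: sumr_ge0 => i _; exact: sqr_ge0.
      have [yr|yr] := leP (rho / 4) `|y k - c|.
        have : 1 <= (\sum_i b i (y k) ^+ 2) / m.
          by rewrite ler_pdivlMr// mul1r; apply: Hm => //; exact: YK.
        by have /andP[] := tent_itv c rho0 (y k); lra.
      have h1 : `|y k - c| / rho <= 1 / 4 by rewrite ler_pdivrMr//; lra.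
      have h2 : 0 <= (\sum_i b i (y k) ^+ 2) / m by rewrite divr_ge0// ltW.
      by have := tent_ge c rho (y k); lra.
    have h1 : `|y k - z k| / rho <= rho^-1 * err.
      by rewrite mulrC ler_pM2l ?invr_gt0// distrC.
    have h2 : (\sum_i b i (y k) ^+ 2) / m <=
        (\sum_i b i (z k) ^+ 2) / m + d%:R * (2 * M * L) / m * err.
      have -> : d%:R * (2 * M * L) / m * err = (d%:R * (2 * M * L) * err) / m by ring.
      by rewrite -mulrDl ler_pM2r ?invr_gt0.
    have := tent_lipschitz c rho0 (y k) (z k).
    rewrite mulrDl; lra.
  have pot := orbit_potential_le tau0 M0 L0 bM bL err2 (Y0 xq) dYx YAx dv (kT _ (leqnn n)).
  have onA j : (j <= n)%N -> `|z j - c| <= A.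
    move=> jn; have := orbit_cball tau0 M0 L0 bM bL err2 (Y0 xq) dYx YAx (kT _ jn).
    have : 0 <= d.+1%:R * (tau * M) by rewrite mulr_ge0// mulr_ge0// ltW.
    rewrite -/(z j); lra.
  have vn : v (z n) - v x <= d%:R * M * (2 * A).
    have xA : `|x - c| <= A by exact: (onA 0%N).
    apply: le_trans (ler_norm _) _; apply: le_trans (vL _ _ (onA _ (leqnn n)) xA) _.
    rewrite ler_pM2l; last by rewrite mulr_gt0.
    have : `|z n - x| <= `|z n - c| + `|c - x| by rewrite -[z n - x](subrKA c) ler_normD.
    by have := onA _ (leqnn n); rewrite [`|c - x|]distrC; lra.
  set S := \sum_(k < n) _ in pot; rewrite ntau -/(z n) in pot.
  have S12 : S / m <= n%:R * (1 / 6).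
    rewrite ler_pdivrMr// -(ler_pM2l tau0).
    have -> : tau * (n%:R * (1 / 6) * m) = (n%:R * tau) * m * (1 / 6) by ring.
    rewrite ntau.
    have h1 : T * m * (1 / 12) = d%:R * M * (2 * A).
      by rewrite /T divfK ?gt_eqF//; field.
    have h2 : T * (d%:R * (2 * L * M * (d.+1%:R * (tau * M)))) <= T * m * (1 / 12).
      rewrite -[leRHS]mulrA ler_pM2l// [leRHS]mulrC -ler_pdivrMr//.
      apply: le_trans (ltW Hn4); rewrite le_eqVlt; apply/orP; left; apply/eqP; ring.
    lra.
  (* The average is at least [3/4 - 1/12 - 1/6 = 1/2]. *)
  have sumtent : n%:R * (1 / 2) <= \sum_(k < n) tent c rho (z k).
    apply: (@le_trans _ _ (\sum_(k < n) (3 / 4 - (d%:R * (2 * M * L) / m + rho^-1) * err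
        - (\sum_i b i (z k) ^+ 2) / m))); last by apply: ler_sum => k _; exact: tentk.
    rewrite sumrB sumr_const card_ord -mulr_suml -/S.
    rewrite -[X in _ <= X - _]mulr_natl.
    have h : (d%:R * (2 * M * L) / m + rho^-1) * err <= 1 / 12.
      by apply: le_trans (ltW Hn5); rewrite errE le_eqVlt; apply/orP; left; apply/eqP; ring.
    have : n%:R * ((d%:R * (2 * M * L) / m + rho^-1) * err) <= n%:R * (1 / 12).
      by rewrite ler_pM2l.
    lra.
  apply: (@le_trans _ _ (\sum_(k < n) expR (- C - 1) * tent c rho (z k))); last first.
    by apply: ler_sum => k _; exact: xF.
  rewrite -mulr_sumr mulrCA ler_pM2l ?expR_gt0//.
  by move: sumtent; rewrite div1r.
have : expR (- C - 1) / 2 * p2%:R ^+ d <= 2.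
  apply: (@grid_le_cube R d c q (expR (- C - 1) / 2) p p2 n F (tent c rho) q0 isT isT n0).
  - by move=> k _; exact: (grid_le_iter_pulls A0 db cb cdb jac0 s k bt).
  - by move=> k x; have [_ h _] := bump_iter_pulls cb cdb jac0 s k bt; exact: h.
  - exact: tent_itv.
  - by move=> x; exact: tent_eq0.
  - exact: avg.
have p2d : p2%:R <= p2%:R ^+ d :> R by rewrite ler_eXnr// ler1n.
have E0 : 0 < expR (- C - 1) :> R by exact: expR_gt0.
have h1 : expR (- C - 1) * (4 * expR (C + 1)) = 4 :> R.
  by rewrite mulrCA -expRD (_ : - C - 1 + (C + 1) = 0) ?expR0 ?mulr1//; ring.
have h2 : 4 < expR (- C - 1) * p2%:R by rewrite -h1 ltr_pM2l.
have h3 : expR (- C - 1) * p2%:R <= expR (- C - 1) * p2%:R ^+ d by rewrite ler_pM2l.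
lra.
Unshelve. all: by end_near. Qed.

End bounded_distortion.

(** * Time reversal and reduction to a forward gradient flow *)

Lemma is_derive_row (R : realType) (d : nat) (Y : R -> 'rV[R]_d) (t : R) (w : 'rV[R]_d) :
  (forall j, is_derive t 1 (fun s => Y s ord0 j) (w ord0 j)) -> is_derive t 1 Y w.
Proof.
move=> H; have dY : derivable Y t 1.
  by apply/derivable_mxP => i j; rewrite (ord1 i); have [] := H j.
apply: DeriveDef => //; rewrite derive_mx//; apply/rowP => j; rewrite mxE.
by have [_ ->] := H j.
Qed.

Lemma is_derive_scale_time (R : realType) (d : nat) (Y : R -> 'rV[R]_d) (a t : R) (w : 'rV[R]_d) :
  is_derive (a * t) 1 Y w -> is_derive t 1 (fun s => Y (a * s)) (a *: w).
Proof.
move=> dY; apply: is_derive_row => j; rewrite mxE mulrC.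
have dj := is_derive_coord j dY.
have da : is_derive t 1 ( *%R a) a.
  by have := @is_deriveZ R R R id a t 1 1 _; rewrite [_ *: 1]mulr1; exact.
exact: (is_derive1_comp (f := fun s => Y s ord0 j)).
Qed.

Lemma continuous_lap (R : realType) (d : nat) (u : 'rV[R]_d -> R) :
  C2 u -> continuous (lap u).
Proof. by move=> [_ _ _ cu]; apply: continuous_sumr => i; exact: cu. Qed.

(* Nothing is known about [X] on the other half-line of times, so [phi] freezes it at
   time 0 there. *)
Lemma lap_antiderivative (R : realType) (d : nat) (u : 'rV[R]_d -> R)
    (X : R -> 'rV[R]_d) (pos : bool) (Cs T : R) : C2 u ->
  (forall t, (if pos then 0 <= t else t <= 0) -> {for t, continuous X}) ->
  (forall t : R, (if pos then 0 <= t else t <= 0) ->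
     (`| \int[lebesgue_measure]_(s in tint pos t) (lap u (X s))%:E | <= Cs%:E)%E) ->
  let sg : R := if pos then 1 else -1 in
  exists D : R -> R,
    (forall t : R, 0 <= t <= T -> is_derive t 1 D (sg * lap u (X (sg * t)))) /\
    (forall t, 0 <= t <= T -> - Cs <= D t - D 0).
Proof.
move=> hu cX HC sg.
have sgK t : sg * (sg * t) = t by rewrite /sg; case: (pos); ring.
pose phi (s : R) := sg * Num.max 0 (sg * s).
have phiP s : if pos then 0 <= phi s else phi s <= 0.
  have : 0 <= Num.max 0 (sg * s) by rewrite le_max lexx.
  by rewrite /phi /sg; case: (pos); rewrite ?mul1r// !mulN1r oppr_le0.
have phiE s : (if pos then 0 <= s else s <= 0) -> phi s = s.
  move=> hs; rewrite /phi; have /max_idPr -> : 0 <= sg * s; last exact: sgK.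
  by move: hs; rewrite /sg; case: (pos); rewrite ?mul1r// mulN1r oppr_ge0.
have cphi : continuous phi.
  move=> s.
  have csg : {for s, continuous (fun _ : R => sg)} by exact: cst_continuous.
  have c0 : {for s, continuous (fun _ : R => 0 : R)} by exact: cst_continuous.
  have cid : {for s, continuous (@id R)} by [].
  exact: (continuousM csg (continuous_max c0 (continuousM csg cid))).
pose h s := lap u (X (phi s)).
have ch : continuous h.
  move=> s; have c1 := continuous_comp (cphi s) (cX _ (phiP s)).
  exact: (continuous_comp c1 (@continuous_lap R d u hu _)).
have [F [dF intF]] := antiderivative (- (`|T| + 1)) ch.
(* The base point [- (|T| + 1)] lies below both [T]-bounded half-lines of times, so [F] is
   differentiable at every [sg * t] with [t] between 0 and [T]. *)
have T0 := ler_norm T.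
exists (fun t => F (sg * t)); split=> t /andP[t0 tT].
  have ht : if pos then 0 <= sg * t else sg * t <= 0.
    by rewrite /sg; case: (pos); rewrite ?mul1r// mulN1r oppr_le0.
  have hl : - (`|T| + 1) < sg * t by rewrite /sg; case: (pos); lra.
  rewrite mulrC -{1}(phiE _ ht).
  have dFt := dF _ hl.
  have da : is_derive t 1 ( *%R sg) sg.
    by have := @is_deriveZ R R R id sg t 1 1 _; rewrite [_ *: 1]mulr1; exact.
  exact: (is_derive1_comp (f := F)).
suff : `|F (sg * t) - F 0| <= Cs by rewrite mulr0 ler_norml => /andP[].
have ht : if pos then 0 <= sg * t else sg * t <= 0.
  by rewrite /sg; case: (pos); rewrite ?mul1r// mulN1r oppr_le0.
have := HC _ ht.
(* On the domain of integration [phi] is the identity, so freezing the flow changes nothing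
   there. *)
have -> : (\int[lebesgue_measure]_(s in tint pos (sg * t)) (lap u (X s))%:E =
    \int[lebesgue_measure]_(s in tint pos (sg * t)) (h s)%:E)%E.
  apply: eq_integral => s; rewrite inE /tint /= => hs; rewrite /h phiE//.
  by move: hs; case: (pos); rewrite in_itv /= => /andP[].
have hT : - (`|T| + 1) < - t by lra.
have h0 : - (`|T| + 1) < 0 by lra.
rewrite /tint /sg; case: (pos); rewrite ?mul1r ?mulN1r.
  by rewrite intF// abse_EFin lee_fin.
by rewrite intF ?oppr_le0// abse_EFin lee_fin distrC.
Qed.

(* pos = true : positively stable case (t >= 0); pos = false : negatively stable (t <= 0) *)
Theorem theorem3p3 (R : realType) (d : nat) (hd : (2 <= d)%N)
  (u : 'rV[R]_d -> R) (hu : C2 u)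
  (X : R -> 'rV[R]_d -> 'rV[R]_d)
  (xs : 'rV[R]_d) (Ks Qs : set 'rV[R]_d) (Cs : R) (pos : bool) :
  grad u xs = 0 ->
  (exists2 N, nbhs xs N & forall y, N y -> grad u y = 0 -> y = xs) ->
  lap u xs = 0 ->
  compact Ks -> nbhs xs Ks ->
  (forall y, Ks y -> grad u y = 0 -> y = xs) ->
  nbhs xs Qs -> Qs `<=` interior Ks ->
  (* X is the gradient flow, along the relevant half-line of times, from points of Qs *)
  (forall x, Qs x -> X 0 x = x) ->
  (forall x (t : R), Qs x -> (if pos then 0 <= t else t <= 0) ->
     is_derive t 1 (fun s => X s x) (grad u (X t x))) ->
  (* stability *)
  (forall x (t : R), Qs x -> (if pos then 0 <= t else t <= 0) -> Ks (X t x)) ->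
  0 < Cs ->
  (forall x (t : R), Qs x -> (if pos then 0 <= t else t <= 0) ->
     (`| \int[lebesgue_measure]_(s in tint pos t)
           (lap u (X s x))%:E | <= Cs%:E)%E) ->
  \forall y \near xs, u y = u xs.
Proof.
move=> _ _ _ cKs _ Ksc nQs _ X0 dX XK _ HC; exfalso.
have [du cdu ddu cddu] := hu.
have [q q0 qQ] : exists2 q, 0 < q & forall x, `|x - xs| <= q -> Qs x.
  have [r /= r0 rQ] := (nbhs_ballP xs Qs).1 nQs.
  exists (r / 2) => [|x xr]; first exact: divr_gt0.
  apply: rQ; rewrite -ball_normE /= distrC (le_lt_trans xr)// ltr_pdivrMr//.
  by rewrite ltr_pMr// ltr1n.
(* For negative times, [X (- t)] follows the gradient flow of [- u] forward in time; the sign [sg]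
   treats both cases at once. *)
pose sg : R := if pos then 1 else -1.
have sg_time t : 0 <= t -> if pos then 0 <= sg * t else sg * t <= 0.
  by move=> t0; rewrite /sg; case: (pos); rewrite ?mul1r// mulN1r oppr_le0.
have dsg (f : 'rV[R]_d -> R) y i : derivable f y (ev R i) ->
    is_derive y (ev R i) (fun z => sg * f z) (sg * pd i f y).
  by move=> /derivableP df; exact: is_deriveZ.
pose b i (y : 'rV[R]_d) := sg * pd i u y.
have pdb i j : pd j (b i) = fun y => sg * pd j (pd i u) y.
  by apply/funext => y; rewrite {1}/pd; have [_ ->] := dsg (pd i u) y j (ddu i j y).
have csg (f : 'rV[R]_d -> R) : continuous f -> continuous (fun y => sg * f y).
  move=> cf y.
  have c1 : {for y, continuous (fun _ : 'rV[R]_d => sg)} by exact: cst_continuous.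
  exact: (continuousM c1 (cf y)).
have sg0 : sg != 0 by rewrite /sg; case: (pos); rewrite ?oppr_eq0 oner_eq0.
apply: (@gradient_flow_not_bounded_distortion R d xs Ks b (fun y => sg * u y) q Cs
  (fun x t => X (sg * t) x)) => //.
- exact: leq_trans hd.
- move=> y Ky by0; apply: Ksc => //; apply/rowP => i; rewrite !mxE.
  by apply/eqP; move/eqP: (by0 i); rewrite mulf_eq0 (negbTE sg0).
- by move=> i j y; have [] := dsg (pd i u) y j (ddu i j y).
- by move=> i; apply: csg; exact: cdu.
- by move=> i j; rewrite pdb; apply: csg; exact: cddu.
- by move=> i y; apply: dsg; exact: du.
- by move=> x /qQ Qx; rewrite mulr0 X0.
- move=> x t /qQ Qx t0.
  have -> : \row_i b i (X (sg * t) x) = sg *: grad u (X (sg * t) x).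
    by apply/rowP => i; rewrite !mxE.
  by apply: (@is_derive_scale_time R d (fun s => X s x)); apply: dX => //; exact: sg_time.
- by move=> x t /qQ Qx t0; apply: XK => //; exact: sg_time.
- move=> x T /qQ Qx T0.
  have [|t ht|D [dD CD]] := @lap_antiderivative R d u (fun s => X s x) pos Cs T hu.
  + by move=> t ht; exact: is_derive_continuous (dX x t Qx ht).
  + exact: HC.
  exists D; split=> // t tT; have := dD t tT.
  congr is_derive; rewrite /lap mulr_sumr; apply: eq_bigr => i _.
  by rewrite pdb.
Qed.
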